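(* Let $\epsilon=1/4$ and, for $j\ge1$, $\lambda_j=\frac12\left(\frac23\right)^j$. Let $m_1=217$, let $c$ be an odd positive integer, and for $j\ge1$ let $m_{j+1}=c^{m_j}$. If $c\ge577$, then the Bramson-Kalikow model $p$ with parameters $\epsilon,(\lambda_j)_{j\ge1},(m_j)_{j\ge1}$ has multiple $p$-measures, i.e. there exist at least two distinct $p$-measures.
   Context: Let $A=\{-1,+1\}$ and $\mathcal X=A^{\mathbb Z_-}$, where $\mathbb Z_-=\{\ldots,-2,-1,0\}$, with the product topology (compact metrizable) and Borel $\sigma$-algebra. $\mathcal C(\mathcal X)$ is the space of continuous real functions on $\mathcal X$ with the sup norm. For $a\in A$ and $x\in\mathcal X$, the concatenation $ax\in\mathcal X$ is defined by $(ax)_0=a$ and $(ax)_{-i-1}=x_{-i}$ for $i\ge0$. The shift $T:\mathcal X\to\mathcal X$ is $(Tx)_i=x_{i-1}$. Let $\mathcal G$ be the set of $g\in\mathcal C(\mathcal X)$ with $g(x)\in(0,1)$ and $\sum_{a\in A}g(ax)=1$ for all $x\in\mathcal X$. For $g\in\mathcal G$, a $g$-measure is a $T$-invariant Borel probability measure $\mu$ on $\mathcal X$ such that $\mu(\{x\in\mathcal X: x_0=a\}\mid T^{-1}\mathcal B)(x)=g(ax_{-\infty}^{-1})$ for $a\in A$ ($\mu$-a.s.), where $\mathcal B$ is the Borel $\sigma$-algebra; equivalently $\int f\,d\mu=\int\sum_{a\in A}g(ax)f(ax)\,d\mu(x)$ for all $f\in\mathcal C(\mathcal X)$. Given $\epsilon\in(0,1/2)$,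 positive numbers $(\lambda_j)_{j\ge1}$ with $\sum_j\lambda_j=1$, and an increasing sequence $(m_j)_{j\ge1}$ of positive odd integers, the Bramson-Kalikow (BK) model is the function $p\in\mathcal G$ given by $p(x)=\sum_{j=1}^\infty\lambda_j\,p_{[m_j]}(x)$, where $$p_{[m_j]}(x)=\mathbf 1\Big\{x_0\sum_{l=1}^{m_j}x_{-l}>0\Big\}(1-\epsilon)+\mathbf 1\Big\{x_0\sum_{l=1}^{m_j}x_{-l}<0\Big\}\epsilon .$$ *)

(* Defs.v *)
From mathcomp Require Import all_boot all_order all_algebra.
From mathcomp Require Import all_classical all_reals all_analysis.

Set Implicit Arguments.
Unset Strict Implicit.
Unset Printing Implicit Defensive.

Import Order.TTheory GRing.Theory Num.Theory.
Import numFieldNormedType.Exports.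

Local Open Scope classical_set_scope.
Local Open Scope ring_scope.

(* The alphabet {-1, +1} is encoded by bool, true standing for +1. *)
Definition spin (a : bool) : int := if a then 1 else -1.

(* A past x = (..., x_{-2}, x_{-1}, x_0) is encoded by the function i |-> x_{-i}
   on nat; cantor_space is nat -> bool with the product topology. *)
Notation past := cantor_space.

Definition borel_past : measurableType _ :=
  g_sigma_algebraType (@open past).

(* (ax)_0 = a and (ax)_{-i-1} = x_{-i} *)
Definition past_cons (a : bool) (x : past) : past :=
  fun i => if i is k.+1 then x k else a.

(* (Tx)_{-i} = x_{-i-1} *)
Definition past_shift (x : past) : past := fun i => x i.+1.

Definition gfun (R : realType) (g : past -> R) : Prop :=
  [/\ continuous g,
      forall x, 0 < g x < 1 &
      forall x, \sum_(a : bool) g (past_cons a x) = 1].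

(* h is a version of the conditional probability P(E | F), where F is a
   sub-sigma-algebra of the ambient one *)
Definition is_cond_prob (R : realType) (d : measure_display)
    (Om : measurableType d) (P : probability Om R) (E : set Om)
    (F : set_system Om) (h : Om -> R) : Prop :=
  [/\ forall Y : set R, measurable Y -> F (h @^-1` Y),
      P.-integrable setT (EFin \o h) &
      forall B : set Om, F B -> P (E `&` B) = \int[P]_(x in B) (h x)%:E]%E.

(* The sigma-algebra T^{-1}B, B being the Borel sigma-algebra *)
Definition strict_past : set_system borel_past :=
  preimage_set_system setT (past_shift : borel_past -> borel_past) measurable.

(* The past x_{-oo}^{-1} of x before time 0 is past_shift x. *)
Definition is_gmeasure (R : realType) (g : past -> R)
    (mu : probability borel_past R) : Prop :=
  [/\ gfun g,
      forall B : set borel_past, measurable B -> mu (past_shift @^-1` B) = mu B &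
      forall a : bool,
        is_cond_prob mu [set x : borel_past | x 0%N = a] strict_past
          (fun x => g (past_cons a (past_shift x)))].

Definition majority_vote (R : realType) (eps : R) (k : nat) (x : past) : R :=
  let s := spin (x 0%N) * \sum_(1 <= l < k.+1) spin (x l) in
  (0 < s)%R%:R * (1 - eps) + (s < 0)%R%:R * eps.

(* lambda and m are indexed from 1; their values at 0 are irrelevant. *)
Definition BK (R : realType) (eps : R) (lambda : nat -> R) (m : nat -> nat)
    (x : past) : R :=
  limn (fun n => \sum_(1 <= j < n.+1) lambda j * majority_vote eps (m j) x).

(* Main.v *)
From HB Require Import structures.
Require Import Defs.
From mathcomp Require Import all_boot all_order all_algebra.
From mathcomp Require Import all_classical all_reals all_analysis.
From mathcomp Require Import measurable_realfun ring lra zify.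

Set Implicit Arguments.
Unset Strict Implicit.
Unset Printing Implicit Defensive.

Import Order.TTheory GRing.Theory Num.Theory.
Import numFieldNormedType.Exports.

Local Open Scope classical_set_scope.
Local Open Scope ring_scope.

(** Write [p] at a past with present spin [a] and strict past [x] as
[(1 + a * d x) / 2]: the drift [d x] is half the weighted sum of the majority
votes of [x]. The votes are odd, so the mirror image of a p-measure under the
global flip of spins is a p-measure, and it suffices to find one under which the
present spin has nonzero mean.

The weights satisfy [lambda_(k+1) + lambda_(k+2) + ... = 2 * lambda_k]: if all
the levels above [k] vote +1, they outweigh level [k] even when it votes -1, and
the levels from [k] on push the next spin up by at least [lambda_k / 2]. This
push lasts as long as no higher level fails, and its effect is measured against
the chain [Q] that only listens to the levels below [k]. That chain has memory
[M = m_(k-1)], is symmetric under the flip and is attractive. It contracts odd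
increasing functions by the factor [1 - 4^-M] every [M] steps
([transfer_contraction]), so its Poisson equation [H - Q H = present spin] has,
up to a small error, an odd increasing solution bounded by [M * 4^M]
([poisson_solution]). By monotonicity of [H], the push turns into a linear
growth of the sum of spins, up to the boundary terms of [H] and a martingale with
increments of variance at most [(M * 4^M)^2]. Chebyshev's inequality over the
window of [m_k] spins and a union bound over the failures of the higher levels
give ([window_bound])

  [f_k <= m_k * C^2 / D^2 + m_k * (f_(k+1) + f_(k+2) + ...)]

for the probability [f_k] that level [k] votes -1, where [C = M * 4^M] and [D] is
of order [m_k * lambda_k]. Since [m_k = c^M] with [c > 576], the product
[m_k * lambda_k^2] is at least of order [256^M], and beats [C^2 = M^2 * 16^M] with
room to spare; at the first level there is nothing below, [C = 1], and 217 spins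
pushed by 1/6 fail with probability less than 0.19, up to the contribution of the higher
levels. A recursion from the top level down ([tail_rare]) shows that the [f_k] have sum at
most 1/4, so that the present spin has mean at least 1/4 ([mean_spin_ge]).

The recursion needs a top level. The estimates are therefore made for the chain
whose levels above [N] always vote +1, uniformly in [N], and [N] tends to
infinity afterwards ([limit_mean]). All of this takes place with finitely
additive means on bounded functions, for which stationary states and limits
come from an ultrafilter. At the end the values of the mean on cylinders are
realized by a probability measure, the law of a coding of a uniform point of the
unit interval ([exists_cylinder_measure]); it is a p-measure because the drift is
a uniform limit of functions of finitely many coordinates
([is_gmeasure_mean]). *)

(** * Averaging over the next spin *)

Definition bounded_by (R : realType) (T : Type) (B : R) (F : T -> R) :=
  forall x, `|F x| <= B.

Section Transfer.
Variable R : realType.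
Implicit Types (d F G H : past -> R) (x y : past).

Definition sgn (b : bool) : R := if b then 1 else -1.

Definition flip x : past := fun i => ~~ x i.

Definition le_past x y := forall i, x i -> y i.

Definition increasing F := forall x y, le_past x y -> F x <= F y.

Definition odd_fun F := forall x, F (flip x) = - F x.

Definition local n F :=
  forall x y, (forall i, (i < n)%N -> x i = y i) -> F x = F y.

(** On the compact space of pasts this is uniform continuity. *)
Definition uniformly_local F := forall e : R, 0 < e ->
  exists n, forall x y, (forall i, (i < n)%N -> x i = y i) -> `|F x - F y| <= e.

(** One step of the chain whose next spin is +1 with probability
[(1 + d x) / 2]: the conditional mean of [F] given the past [x]. *)
Definition transfer d F : past -> R := fun x =>
  (1 + d x) / 2 * F (past_cons true x) + (1 - d x) / 2 * F (past_cons false x).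

Lemma sgn_increasing (a b : bool) : (a -> b) -> sgn a <= sgn b.
Proof. by move: a b => [] [] /= h; rewrite /sgn; [|have := h isT|lra|]. Qed.

Lemma sgn_negb b : sgn (~~ b) = - sgn b.
Proof. by case: b => //=; rewrite opprK. Qed.

Lemma flip_cons a x : flip (past_cons a x) = past_cons (~~ a) (flip x).
Proof. by apply/funext => -[|i]. Qed.

Lemma shift_cons a x : past_shift (past_cons a x) = x.
Proof. exact/funext. Qed.

Lemma iter_shiftE t x i : iter t past_shift x i = x (t + i)%N.
Proof. by elim: t i => //= t IH i; rewrite /past_shift IH addnS. Qed.

Lemma le_past_cons a x y : le_past x y -> le_past (past_cons a x) (past_cons a y).
Proof. by move=> xy [|i] //=; exact: xy. Qed.

Lemma transfer_of_shift d F x : transfer d (F \o past_shift) x = F x.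
Proof. by rewrite /transfer /= !shift_cons; field. Qed.

Lemma transfer_sgn d x : transfer d (fun y => sgn (y 0%N)) x = d x.
Proof. by rewrite /transfer /sgn /=; field. Qed.

Lemma transfer_lin d a F G x :
  transfer d (fun y => a * F y + G y) x = a * transfer d F x + transfer d G x.
Proof. by rewrite /transfer; ring. Qed.

(** How the operator reacts to a change of drift; for increasing [F] the bracket
is nonnegative, so pushing the spins up pushes the mean of [F] up. *)
Lemma transfer_drift d d' F x :
  transfer d F x = transfer d' F x
    + (d x - d' x) / 2 * (F (past_cons true x) - F (past_cons false x)).
Proof. by rewrite /transfer; ring. Qed.

Lemma transfer_le d F G x : bounded_by 1 d -> (forall y, F y <= G y) ->
  transfer d F x <= transfer d G x.
Proof.
move=> /(_ x); rewrite ler_norml => /andP[d1 d2] FG.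
by rewrite /transfer lerD // ler_wpM2l //; lra.
Qed.

Lemma transfer_bounded d B F : bounded_by 1 d -> bounded_by B F ->
  bounded_by B (transfer d F).
Proof.
move=> d1 FB x; have h (c : R) : transfer d (fun=> c) x = c.
  by rewrite /transfer; field.
rewrite ler_norml -{1}(h (- B)) -{2}(h B) !transfer_le // => y;
by have := FB y; rewrite ler_norml => /andP[].
Qed.

(** Attractiveness: raising the past raises the drift, hence the next spin. *)
Lemma transfer_increasing d F : bounded_by 1 d -> increasing d ->
  increasing F -> increasing (transfer d F).
Proof.
move=> d1 id iF x y xy; rewrite (transfer_drift d (fun=> d x)).
rewrite [leRHS](transfer_drift d (fun=> d x)) subrr mul0r mul0r addr0.
have Fpm : F (past_cons false y) <= F (past_cons true y) by apply: iF => -[].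
have dxy := id _ _ xy.
rewrite -[leLHS]addr0 lerD // ?mulr_ge0 //; [|lra|lra].
have := d1 x; rewrite ler_norml /transfer => /andP[dx1 dx2].
by rewrite lerD // ler_wpM2l ?iF //; first [lra|exact: le_past_cons].
Qed.

Lemma transfer_odd d F : odd_fun d -> odd_fun F -> odd_fun (transfer d F).
Proof.
move=> od oF x; rewrite /transfer od.
have h a : F (past_cons a (flip x)) = - F (past_cons (~~ a) x).
  by rewrite -oF flip_cons negbK.
by rewrite !h /=; ring.
Qed.

Lemma transfer_local n d F : local n d -> local n F -> local n (transfer d F).
Proof.
move=> ld lF x y xy; rewrite /transfer (ld _ _ xy).
have h a : F (past_cons a x) = F (past_cons a y).
  by apply: lF => -[|i] //= /ltnW; exact: xy.
by rewrite !h.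
Qed.

(** * The Poisson equation of an attractive symmetric chain *)

Section Poisson.
Variables (d : past -> R) (n : nat).
Hypotheses (d2 : bounded_by (1 / 2) d) (d_inc : increasing d)
  (d_odd : odd_fun d) (d_loc : local n d) (n_gt0 : (0 < n)%N).

Let d1 : bounded_by 1 d.
Proof. by move=> x; apply: le_trans (d2 x) _; lra. Qed.

(** Each step draws -1 with probability at least 1/4, so after [i] steps the
past starts with [i] minuses with probability at least [4^-i]. *)
Lemma iter_transfer_le B F i x : (forall y, F y <= B) ->
  iter i (transfer d) F x
    <= B - 4^-1 ^+ i * (B - F (iter i (past_cons false) x)).
Proof.
move=> FB; have FBi j y : iter j (transfer d) F y <= B.
  elim: j y => [|j IH] y //=; have -> : B = transfer d (fun=> B) y.
    by rewrite /transfer; field.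
  exact: transfer_le.
elim: i x => [|i IH] x; first by rewrite expr0 /=; lra.
rewrite [iter i.+1 _ F]iterS iterSr {1}/transfer.
have := d2 x; rewrite ler_norml => /andP[dx1 dx2].
set p := (1 + d x) / 2.
have -> : (1 - d x) / 2 = 1 - p by rewrite /p; field.
have p1 : 1 - p >= 4^-1 by rewrite /p; lra.
have p0 : 0 <= p by rewrite /p; lra.
set y := past_cons false x; set z := past_cons true x.
apply: (@le_trans _ _ (p * B +
   (1 - p) * (B - 4^-1 ^+ i * (B - F (iter i (past_cons false) y))))).
  by rewrite lerD // ler_wpM2l //; lra.
set e := 4^-1 ^+ i * _; rewrite exprS -mulrA -/e.
have e0 : 0 <= e by rewrite mulr_ge0 ?exprn_ge0 ?subr_ge0 ?invr_ge0.
nra.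
Qed.

(** With [i = n] above, the past is all minus on the window that [F] sees, and
there an odd increasing function is nonpositive: a fraction [4^-n] of the bound
is lost. The lower bound is the same statement for the flipped past. *)
Lemma transfer_contraction B F : increasing F -> odd_fun F -> local n F ->
  bounded_by B F -> bounded_by ((1 - 4^-1 ^+ n) * B) (iter n (transfer d) F).
Proof.
move=> iF oF lF FB.
have ub x : iter n (transfer d) F x <= (1 - 4^-1 ^+ n) * B.
  apply: le_trans (iter_transfer_le _ _ _) _.
    by move=> y; have := FB y; rewrite ler_norml => /andP[_]; exact.
  have -> : F (iter n (past_cons false) x) = F (fun=> false).
    apply: lF => i; elim: n i => // j IH [|i] //=; exact: IH.
  have F0 : F (fun=> false) <= 0.
    have := iF (fun=> false) (flip (fun=> false)) (fun i (_ : false) => isT).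
    by rewrite oF; lra.
  have : 0 <= 4^-1 ^+ n * (- F (fun=> false)).
    by rewrite mulr_ge0 ?oppr_ge0 // exprn_ge0 ?invr_ge0.
  lra.
have io : odd_fun (iter n (transfer d) F).
  by elim: (n) => //= j; exact: transfer_odd.
move=> x; rewrite ler_norml ub andbT -(opprK (iter _ _ _ _)) lerN2.
by rewrite -io ub.
Qed.

Local Notation s0 := (fun x : past => sgn (x 0%N)).

Lemma spin0_increasing : increasing s0.
Proof. by move=> x y /(_ 0%N); exact: sgn_increasing. Qed.

Lemma spin0_odd : odd_fun s0.
Proof. by move=> x; rewrite /flip sgn_negb. Qed.

Lemma spin0_bounded : bounded_by 1 s0.
Proof. by move=> x; rewrite /sgn; case: ifP; rewrite ?normrN normr1. Qed.

Let iter_s0 i : [/\ increasing (iter i (transfer d) s0),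
  odd_fun (iter i (transfer d) s0), local n (iter i (transfer d) s0) &
  bounded_by 1 (iter i (transfer d) s0)].
Proof.
elim: i => [|i [iF oF lF bF]].
  split; [exact: spin0_increasing|exact: spin0_odd| |exact: spin0_bounded].
  by move=> x y xy /=; rewrite xy.
split=> /=; [exact: transfer_increasing|exact: transfer_odd|
  exact: transfer_local|exact: transfer_bounded].
Qed.

Let iter_s0_decay r i :
  bounded_by ((1 - 4^-1 ^+ n) ^+ r) (iter (i + n * r) (transfer d) s0).
Proof.
elim: r i => [|r IH] i.
  by rewrite muln0 addn0 expr0; case: (iter_s0 i).
rewrite mulnS addnCA iterD exprS; have [iF oF lF _] := iter_s0 (i + n * r).
exact: transfer_contraction.
Qed.

Let poisson_sum k : past -> R :=
  fun x => \sum_(i < k) iter i (transfer d) s0 x.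

Let poisson_sum_bounded r :
  bounded_by (n%:R * 4 ^+ n * (1 - (1 - 4^-1 ^+ n) ^+ r))
    (poisson_sum (n * r)).
Proof.
elim: r => [|r IH] x.
  by rewrite /poisson_sum muln0 big_ord0 normr0 expr0 subrr mulr0.
have -> : poisson_sum (n * r.+1) x = poisson_sum (n * r) x +
    \sum_(i < n) iter (i + n * r) (transfer d) s0 x.
  rewrite /poisson_sum mulnSr big_split_ord /=.
  by congr (_ + _); apply: eq_bigr => i _; rewrite addnC.
apply: le_trans (ler_normD _ _) _.
have h : `|\sum_(i < n) iter (i + n * r) (transfer d) s0 x|
    <= n%:R * (1 - 4^-1 ^+ n) ^+ r.
  apply: le_trans (ler_norm_sum _ _ _) _.
  rewrite mulr_natl -[n in _ *+ n]card_ord -sumr_const.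
  by apply: ler_sum => i _; exact: iter_s0_decay.
apply: le_trans (lerD (IH x) h) _; rewrite le_eqVlt; apply/orP; left.
rewrite exprS; have : 4 ^+ n * 4^-1 ^+ n = 1 :> R.
  by rewrite -exprMn divff // expr1n.
set a := 4 ^+ n; set b := 4^-1 ^+ n => ab; apply/eqP.
by transitivity (n%:R * a * (1 - (1 - b) * (1 - b) ^+ r) + n%:R * (1 - b) ^+ r * (1 - a * b)); [ring|rewrite ab; ring].
Qed.

(** [H] is a partial sum of the Neumann series of the present spin. By the
contraction the series is dominated by a geometric one, each term being
repeated [n] times, hence the bound [n * 4 ^ n]; the first term alone has gap 2
between the two values of the present spin, and the others, being increasing,
only widen it. *)
Lemma poisson_solution eta : 0 < eta -> exists H,
  [/\ bounded_by (n%:R * 4 ^+ n) H,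
      forall x, 2 <= H (past_cons true x) - H (past_cons false x) &
      forall x, H x - sgn (x 0%N) - eta <= transfer d H x].
Proof.
move=> eta0; set t : R := 1 - 4^-1 ^+ n.
have t01 : 0 <= t < 1.
  have := exprn_gt0 n (_ : 0 < 4^-1 :> R); rewrite invr_gt0 ltr0n => /(_ isT) h.
  rewrite /t subr_ge0 exprn_ile1 ?invr_ge0 ?invf_le1 //=; lra.
have [r r_gt0 tr] : exists2 r, (0 < r)%N & t ^+ r <= eta.
  have tc : (fun k => t ^+ k) @ \oo --> 0.
    by apply: cvg_expr; rewrite ger0_norm; case/andP: t01.
  move/cvgrPdist_le: tc => /(_ _ eta0)[r _ hr]; exists r.+1 => //.
  have := hr r.+1 (leqnSn r); rewrite sub0r normrN; apply: le_trans.
  exact: ler_norm.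
exists (poisson_sum (n * r)); split.
- move=> x; apply: le_trans (poisson_sum_bounded r x) _.
  rewrite ler_piMr ?mulr_ge0 ?exprn_ge0 //.
  by rewrite lerBlDr lerDl exprn_ge0 //; case/andP: t01.
- move=> x; rewrite /poisson_sum -sumrB.
  have -> : (n * r)%N = (n * r).-1.+1 by rewrite prednK // muln_gt0 n_gt0.
  rewrite big_ord_recl /= {1 2}/sgn opprK -[leLHS]addr0 lerD //.
  apply: sumr_ge0 => i _; rewrite subr_ge0.
  by have [+ _ _ _] := iter_s0 (bump 0 i); apply=> -[].
- move=> x; have -> : transfer d (poisson_sum (n * r)) x =
      poisson_sum (n * r) x - sgn (x 0%N) + iter (n * r) (transfer d) s0 x.
    rewrite /poisson_sum; elim: (n * r)%N => [|k IH].
      by rewrite /transfer !big_ord0 /=; ring.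
    rewrite big_ord_recr /=.
    have -> : transfer d (fun y => \sum_(i < k.+1) iter i (transfer d) s0 y) x =
        1 * transfer d (fun y => \sum_(i < k) iter i (transfer d) s0 y) x +
        transfer d (iter k (transfer d) s0) x.
      by rewrite /transfer !big_ord_recr /=; ring.
    by rewrite IH; ring.
  rewrite lerD2l; have := iter_s0_decay r 0 x.
  by rewrite add0n ler_norml -/t; lra.
Qed.

End Poisson.
End Transfer.
(** * Invariant means *)

Section Means.
Variable R : realType.

Definition bounded_fun (T : Type) (F : T -> R) := exists B, bounded_by B F.

(** Expectations that are only finitely additive, but defined on all bounded
functions: no measurability or continuity is needed until the very end, and
limits along an ultrafilter stay in this class. *)
Record is_mean (T : Type) (L : (T -> R) -> R) : Prop := IsMean {
  mean1 : L (fun=> 1) = 1;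
  mean_lin : forall a F G, bounded_fun F -> bounded_fun G ->
    L (fun x => a * F x + G x) = a * L F + L G;
  mean_ge0 : forall F, bounded_fun F -> (forall x, 0 <= F x) -> 0 <= L F }.

Section Bounded.
Variable T : Type.
Implicit Types F G : T -> R.

Lemma bounded_const (c : R) : bounded_fun (fun _ : T => c).
Proof. by exists `|c|. Qed.

Lemma boundedD F G : bounded_fun F -> bounded_fun G ->
  bounded_fun (fun x => F x + G x).
Proof.
move=> [B FB] [C GC]; exists (B + C) => x.
by apply: le_trans (ler_normD _ _) _; rewrite lerD.
Qed.

Lemma boundedM F G : bounded_fun F -> bounded_fun G ->
  bounded_fun (fun x => F x * G x).
Proof. by move=> [B FB] [C GC]; exists (B * C) => x; rewrite normrM ler_pM. Qed.

Lemma boundedN F : bounded_fun F -> bounded_fun (fun x => - F x).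
Proof. by move=> [B FB]; exists B => x; rewrite normrN. Qed.

Lemma boundedB F G : bounded_fun F -> bounded_fun G ->
  bounded_fun (fun x => F x - G x).
Proof. by move=> bF bG; apply: boundedD => //; exact: boundedN. Qed.

Lemma bounded_sum (I : Type) (r : seq I) (F : I -> T -> R) :
  (forall i, bounded_fun (F i)) -> bounded_fun (fun x => \sum_(i <- r) F i x).
Proof.
move=> bF; elim: r => [|i r IH].
  by exists 0 => x; rewrite big_nil normr0.
have [B hB] := boundedD (bF i) IH.
by exists B => x; rewrite big_cons; exact: hB.
Qed.

Lemma bounded_comp (S : Type) (h : S -> T) F :
  bounded_fun F -> bounded_fun (fun x => F (h x)).
Proof. by move=> [B FB]; exists B => x. Qed.

End Bounded.

Section MeanTheory.
Variables (T : Type) (L : (T -> R) -> R).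
Hypothesis mL : is_mean L.
Implicit Types F G : T -> R.

Let b0 (c : R) : bounded_fun (fun _ : T => c) := bounded_const T c.

Lemma mean0 : L (fun=> 0) = 0.
Proof.
have := mean_lin mL 1 (b0 0) (b0 0).
by rewrite !mul1r addr0 => /eqP; rewrite addrC -subr_eq subrr => /eqP.
Qed.

Lemma meanZ a F : bounded_fun F -> L (fun x => a * F x) = a * L F.
Proof.
move=> bF; have := mean_lin mL a bF (b0 0); rewrite mean0 addr0 => <-.
by congr L; apply/funext => x; rewrite addr0.
Qed.

Lemma mean_cst c : L (fun=> c) = c.
Proof.
by have := meanZ c (b0 1); rewrite (mean1 mL) !mulr1.
Qed.

Lemma meanD F G : bounded_fun F -> bounded_fun G ->
  L (fun x => F x + G x) = L F + L G.
Proof.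
move=> bF bG; have := mean_lin mL 1 bF bG; rewrite mul1r => <-.
by congr L; apply/funext => x; rewrite mul1r.
Qed.

Lemma meanB F G : bounded_fun F -> bounded_fun G ->
  L (fun x => F x - G x) = L F - L G.
Proof.
move=> bF bG; have := mean_lin mL (-1) bG bF; rewrite mulN1r addrC => <-.
by congr L; apply/funext => x; rewrite mulN1r addrC.
Qed.

Lemma mean_le F G : bounded_fun F -> bounded_fun G ->
  (forall x, F x <= G x) -> L F <= L G.
Proof.
move=> bF bG FG; rewrite -subr_ge0 -meanB //.
by apply: (mean_ge0 mL) => [|x]; [exact: boundedB|rewrite subr_ge0].
Qed.

Lemma mean_sum (I : Type) (r : seq I) (F : I -> T -> R) :
  (forall i, bounded_fun (F i)) ->
  L (fun x => \sum_(i <- r) F i x) = \sum_(i <- r) L (F i).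
Proof.
move=> bF; elim: r => [|i r IH].
  rewrite big_nil -[RHS]mean0; congr L.
  by apply/funext => x; rewrite big_nil.
rewrite big_cons -IH -meanD //; last exact: bounded_sum.
by congr L; apply/funext => x; rewrite big_cons.
Qed.

Lemma mean_bounded B F : bounded_by B F -> `|L F| <= B.
Proof.
move=> FB; have bF : bounded_fun F by exists B.
rewrite ler_norml -{1}(mean_cst (- B)) -{2}(mean_cst B) !mean_le // => x;
by have := FB x; rewrite ler_norml => /andP[].
Qed.

End MeanTheory.

(** Any bounded sequence converges along an ultrafilter finer than that of
cofinite sets. *)
Lemma generalized_limit : exists Lim : (nat -> R) -> R, is_mean Lim /\
  forall u, bounded_fun u -> (\forall n \near \oo, 0 <= u n) -> 0 <= Lim u.
Proof.
have [U [UU leU]] := @ultraFilterLemma nat \oo _.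
have cvU (u : nat -> R) : bounded_fun u -> cvg (u @ U).
  move=> [B uB]; have [] := @segment_compact R (- B) B (u @ U) _.
    change (U (u @^-1` [set` `[- B, B]])).
    apply: filterS (@filterT _ U _) => n _ /=.
    by rewrite in_itv /= -ler_norml; exact: uB.
  move=> l [_ clu]; apply/cvg_ex; exists l => V Vl.
  have [//|UVC] := in_ultra_setVsetC (u @^-1` V) UU.
  have [] := clu (~` V) V UVC Vl; by move=> x [].
have Ulim (u : nat -> R) : bounded_fun u ->
    (\forall n \near \oo, 0 <= u n) -> 0 <= lim (u @ U).
  by move=> bu u0; apply: limr_ge; [exact: cvU|exact: leU].
exists (fun u => lim (u @ U)); split=> //; split.
- exact: lim_cst.
- move=> a u v bu bv.
  apply: cvg_lim => //; apply: cvgD; last exact: cvU.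
  by apply: cvgMl_tmp; exact: cvU.
- by move=> u bu u0; apply: Ulim => //; exact: nearW.
Qed.

Lemma mean_family_limit (T I : Type) (Lim : (I -> R) -> R)
    (Ls : I -> (T -> R) -> R) :
  is_mean Lim -> (forall i, is_mean (Ls i)) ->
  is_mean (fun F => Lim (fun i => Ls i F)).
Proof.
move=> mLim mLs.
have bLs F : bounded_fun F -> bounded_fun (fun i => Ls i F).
  by move=> [B FB]; exists B => i; exact: mean_bounded.
split.
- rewrite -[RHS](mean1 mLim); congr Lim; apply/funext => i.
  exact: mean1.
- move=> a F G bF bG; rewrite -(mean_lin mLim) //; try exact: bLs.
  by congr Lim; apply/funext => i; rewrite (mean_lin (mLs i)).
- move=> F bF F0; apply: (mean_ge0 mLim) => [|i]; first exact: bLs.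
  exact: mean_ge0.
Qed.

Lemma mean_eval (T : Type) (x : T) : is_mean (fun F : T -> R => F x).
Proof. by split. Qed.

Lemma bounded_transfer (d F : past -> R) : bounded_by 1 d -> bounded_fun F ->
  bounded_fun (transfer d F).
Proof. by move=> d1 [B FB]; exists B; exact: transfer_bounded. Qed.

Lemma mean_transfer (d : past -> R) L : bounded_by 1 d -> is_mean L ->
  is_mean (fun F => L (transfer d F)).
Proof.
move=> d1 mL; split.
- rewrite -[RHS](mean1 mL); congr L; apply/funext => x.
  by rewrite /transfer; field.
- move=> a F G bF bG; rewrite -(mean_lin mL) //; try exact: bounded_transfer.
  by congr L; apply/funext => x; rewrite transfer_lin.
- move=> F bF F0; apply: (mean_ge0 mL) => [|x]; first exact: bounded_transfer.
  have := d1 x; rewrite ler_norml /transfer => /andP[? ?].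
  by rewrite addr_ge0 // mulr_ge0 //; lra.
Qed.

(** When [L] is a mean, this also makes it invariant under the shift. *)
Definition stationary (d : past -> R) (L : (past -> R) -> R) :=
  forall F, bounded_fun F -> L (transfer d F) = L F.

Lemma near_inv_small (B e : R) : 0 < e ->
  \forall n \near \oo, B * n.+1%:R^-1 <= e.
Proof.
move=> e0; have : (fun n => B * n.+1%:R^-1) @ \oo --> B * 0.
  by apply: cvgMl_tmp; exact: cvg_harmonic.
rewrite mulr0 => /cvgrPdist_le /(_ _ e0); apply: filterS => n.
by rewrite sub0r normrN; apply: le_trans; exact: ler_norm.
Qed.

Lemma generalized_limit_small Lim (u : nat -> R) :
  is_mean Lim ->
  (forall u, bounded_fun u -> (\forall n \near \oo, 0 <= u n) -> 0 <= Lim u) ->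
  bounded_fun u -> (forall e, 0 < e -> \forall n \near \oo, `|u n| <= e) ->
  Lim u = 0.
Proof.
move=> mLim LimP bu us; apply/eqP; rewrite -normr_eq0 eq_le normr_ge0 andbT.
apply/ler_addgt0Pr => e e0; rewrite add0r ler_norml.
have be := bounded_const nat e.
have h1 : 0 <= Lim (fun n => e - u n).
  apply: LimP; first exact: boundedB.
  by apply: filterS (us _ e0) => n; rewrite ler_norml subr_ge0 => /andP[].
have h2 : 0 <= Lim (fun n => u n + e).
  apply: LimP; first exact: boundedD.
  by apply: filterS (us _ e0) => n; rewrite ler_norml => /andP[]; lra.
move: h1 h2; rewrite meanB // meanD // mean_cst //; lra.
Qed.

(** Krylov and Bogolyubov: a generalized limit of the time averages along the
chain started from the all plus past. *)
Lemma exists_stationary (d : past -> R) : bounded_by 1 d ->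
  exists L, is_mean L /\ stationary d L.
Proof.
move=> d1; have [Lim [mLim LimP]] := generalized_limit.
pose x0 : past := fun=> true.
pose Ls n (F : past -> R) :=
  n.+1%:R^-1 * \sum_(i < n.+1) iter i (transfer d) F x0.
have mi i : is_mean (fun F => iter i (transfer d) F x0).
  elim: i => [|i IH]; first exact: mean_eval.
  have := mean_transfer d1 IH; congr is_mean; apply/funext => F.
  by rewrite iterSr.
have mLs n : is_mean (Ls n).
  have n0 : n.+1%:R != 0 :> R by rewrite pnatr_eq0.
  split.
  - rewrite /Ls (eq_bigr (fun=> 1)) => [|i _]; last exact: mean1 (mi i).
    by rewrite sumr_const card_ord mulVf.
  - move=> a F G bF bG; rewrite /Ls mulrCA -mulrDr [a * _]mulr_sumr -big_split /=.
    by congr (_ * _); apply: eq_bigr => i _; rewrite (mean_lin (mi i)).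
  - move=> F bF F0; rewrite mulr_ge0 ?invr_ge0 // sumr_ge0 // => i _.
    exact: mean_ge0 (mi i) _ _ _.
have mL := mean_family_limit mLim mLs.
exists (fun F => Lim (fun n => Ls n F)); split=> // F [B FB].
have bF : bounded_fun F by exists B.
have bLs G : bounded_fun G -> bounded_fun (fun n => Ls n G).
  by move=> [C GC]; exists C => n; exact: mean_bounded.
have bdF := bounded_transfer d1 bF.
apply/eqP; rewrite -subr_eq0 -(meanB mLim (bLs _ bdF) (bLs _ bF)).
apply/eqP/(generalized_limit_small mLim LimP).
  exact: boundedB (bLs _ bdF) (bLs _ bF).
move=> e e0; apply: filterS (near_inv_small (B + B) e0) => n.
apply: le_trans; rewrite /Ls -mulrBr normrM ger0_norm ?invr_ge0 // mulrC.
rewrite ler_wpM2r ?invr_ge0 //.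
have -> : \sum_(i < n.+1) iter i (transfer d) (transfer d F) x0 -
    \sum_(i < n.+1) iter i (transfer d) F x0 =
    iter n.+1 (transfer d) F x0 - F x0.
  elim: n => [|n IH]; first by rewrite !big_ord1.
  rewrite big_ord_recr [X in _ - X]big_ord_recr /= -iterSr opprD addrACA IH /=.
  ring.
apply: le_trans (ler_normB _ _) _.
by apply: lerD => //; apply: (mean_bounded (mi n.+1)).
Qed.

End Means.
(** * The majority over a window of a pushed chain *)

Section Window.
Variable R : realType.

Definition fail m (x : past) : R :=
  (\sum_(i < m) sgn R (x i) <= 0)%R%:R.

Lemma bounded_fail m : bounded_fun (fail m).
Proof. by exists 1 => x; rewrite /fail; case: (_ <= 0); rewrite ?normr0 ?normr1. Qed.

Lemma fail_ge0 m x : 0 <= fail m x.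
Proof. exact: ler0n. Qed.

Variables (d : past -> R) (L : (past -> R) -> R).
Hypotheses (d1 : bounded_by 1 d) (mL : is_mean L) (sL : stationary d L).

Lemma stationary_shift F : bounded_fun F -> L (fun x => F (past_shift x)) = L F.
Proof.
move=> bF; rewrite -sL; last exact: bounded_comp.
by congr L; apply/funext => x; exact: transfer_of_shift.
Qed.

Lemma stationary_shift_iter t F : bounded_fun F ->
  L (fun x => F (iter t past_shift x)) = L F.
Proof.
move=> bF; elim: t => //= t <-.
rewrite -[RHS]stationary_shift; last exact: bounded_comp.
by congr L; apply/funext => x; rewrite -iterSr.
Qed.

(** The past at time 0 contains the whole history, so the martingale of the last
[m] increments of [H] is a function of it. *)
Definition martingale (H : past -> R) m (x : past) : R :=
  \sum_(t < m) (H (iter t past_shift x) - transfer d H (iter t.+1 past_shift x)).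

Lemma martingaleS H m x : martingale H m.+1 x =
  H x - transfer d H (past_shift x) + martingale H m (past_shift x).
Proof.
rewrite /martingale big_ord_recl /=; congr (_ + _).
by apply: eq_bigr => t _; rewrite -!iterS !iterSr.
Qed.

Lemma bounded_martingale H m : bounded_fun H -> bounded_fun (martingale H m).
Proof.
move=> bH; apply: bounded_sum => t; apply: boundedB; first exact: bounded_comp.
by apply: (bounded_comp (iter t.+1 past_shift)); exact: bounded_transfer.
Qed.

(** Increments are orthogonal: averaging over the present spin removes the cross
term and leaves the conditional variance of [H], which is at most [C ^+ 2]. *)
Lemma martingale_variance C H m : bounded_by C H ->
  L (fun x => martingale H m x ^+ 2) <= m%:R * C ^+ 2.
Proof.
move=> HC; have bH : bounded_fun H by exists C.
have bM k : bounded_fun (fun x => martingale H k x ^+ 2).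
  by apply: boundedM; exact: bounded_martingale.
have bC : bounded_fun (fun _ : past => C ^+ 2) by exact: bounded_const.
elim: m => [|m IH].
  rewrite mul0r (_ : (fun _ => _) = fun=> 0) ?mean_cst //.
  by apply/funext => x; rewrite /martingale big_ord0 expr0n.
apply: (@le_trans _ _ (L (fun x => C ^+ 2 + martingale H m x ^+ 2))); last first.
  by rewrite meanD // mean_cst // -natr1 mulrDl mul1r addrC lerD.
rewrite -sL //; apply: mean_le => // [||x].
- exact: bounded_transfer.
- exact: boundedD.
rewrite {1}/transfer !martingaleS !shift_cons /transfer.
set G := martingale H m x; set h := H _; set k := H _.
have [hC kC] : h ^+ 2 <= C ^+ 2 /\ k ^+ 2 <= C ^+ 2.
  by rewrite -(real_normK (num_real h)) -(real_normK (num_real k)) !lerXn2r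
    ?nnegrE ?(le_trans (normr_ge0 _) (HC x)) //; exact: HC.
have := d1 x; rewrite ler_norml => /andP[dx1 dx2].
set p := (1 + d x) / 2; have -> : (1 - d x) / 2 = 1 - p by rewrite /p; field.
have p0 : 0 <= p by rewrite /p; lra.
have p1 : 0 <= 1 - p by rewrite /p; lra.
have -> : p * (h - (p * h + (1 - p) * k) + G) ^+ 2
    + (1 - p) * (k - (p * h + (1 - p) * k) + G) ^+ 2
  = p * h ^+ 2 + (1 - p) * k ^+ 2 - (p * h + (1 - p) * k) ^+ 2 + G ^+ 2 by ring.
have := sqr_ge0 (p * h + (1 - p) * k).
have := ler_wpM2l p0 hC; have := ler_wpM2l p1 kC; lra.
Qed.

(** Where [bad] is below 1 the drift exceeds the reference drift [d0] by [lam]. As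
[H] solves the Poisson equation of [d0] up to [eta] and has gap at least 2, such
pasts satisfy [H - transfer d H <= present spin - (lam - eta)]. Summing over the
window, a nonpositive sum of spins forces the martingale below [- D], the
term [2 * C] being the cost of the two boundary values of [H]. Chebyshev's
inequality and a union bound over the bad times conclude. *)
Lemma window_bound (d0 H bad : past -> R) (C eta lam : R) (m : nat) :
  0 <= lam -> bounded_by C H ->
  (forall x, 2 <= H (past_cons true x) - H (past_cons false x)) ->
  (forall x, H x - sgn R (x 0%N) - eta <= transfer d0 H x) ->
  bounded_fun bad -> (forall x, 0 <= bad x) ->
  (forall x, bad x < 1 -> d0 x + lam <= d x) ->
  let D := m%:R * (lam - eta) - 2 * C in 0 < D ->
  L (fail m) <= m%:R * C ^+ 2 / D ^+ 2 + m%:R * L bad.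
Proof.
move=> lam0 HC Hgap Hpoisson bbad bad0 hbad D D0.
have bH : bounded_fun H by exists C.
have bM : bounded_fun (fun x => D ^- 2 * martingale H m x ^+ 2).
  apply: boundedM; first exact: bounded_const.
  by apply: boundedM; exact: bounded_martingale.
have bS : bounded_fun (fun x => \sum_(t < m) bad (iter t.+1 past_shift x)).
  by apply: bounded_sum => t; exact: (bounded_comp (iter t.+1 past_shift)).
have -> : m%:R * L bad = L (fun x => \sum_(t < m) bad (iter t.+1 past_shift x)).
  rewrite mean_sum //; last by move=> t; exact: (bounded_comp (iter t.+1 past_shift)).
  rewrite (eq_bigr (fun=> L bad)) => [|t _]; last exact: stationary_shift_iter.
  by rewrite sumr_const card_ord mulr_natl.
rewrite -(stationary_shift (bounded_fail m)).
apply: (@le_trans _ _ (L (fun x => D ^- 2 * martingale H m x ^+ 2 +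
    \sum_(t < m) bad (iter t.+1 past_shift x)))); last first.
  rewrite meanD // lerD2r meanZ //; last first.
    by apply: boundedM; exact: bounded_martingale.
  rewrite mulrC ler_wpM2r ?invr_ge0 ?sqr_ge0 //.
  exact: martingale_variance.
apply: mean_le => //; [|exact: boundedD|].
  exact/bounded_comp/bounded_fail.
(* Chebyshev's inequality, as a pointwise bound of the failure indicator. *)
move=> x; set S := \sum_(t < m) _.
have S0 : 0 <= S by apply: sumr_ge0.
have M0 : 0 <= D ^- 2 * martingale H m x ^+ 2.
  by rewrite mulr_ge0 ?invr_ge0 ?sqr_ge0.
rewrite /fail; have [sum_le0|_] := boolP (_ <= 0); last exact: addr_ge0.
have [S1|S1] := leP 1 S; first by rewrite -[1%:R]add0r lerD.
have good t : (t < m)%N ->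
    d0 (iter t.+1 past_shift x) + lam <= d (iter t.+1 past_shift x).
  move=> tm; apply: hbad; apply: le_lt_trans S1.
  rewrite /S (bigD1 (Ordinal tm)) //= lerDl; exact: sumr_ge0.
have drift : martingale H m x <= H x - H (iter m past_shift x)
    + \sum_(i < m) sgn R (past_shift x i) - m%:R * (lam - eta).
  have -> : \sum_(i < m) sgn R (past_shift x i) =
      \sum_(t < m) sgn R (iter t.+1 past_shift x 0%N).
    by apply: eq_bigr => i _; rewrite iter_shiftE addn0.
  rewrite /martingale; elim: (m) good => [|k IH] good.
    by rewrite !big_ord0 mul0r subrr addr0 subr0.
  rewrite !big_ord_recr /= -(natr1 k).
  have := IH (fun t tk => good t (ltnW tk)); have := good k (ltnSn k).
  rewrite /=; set y := past_shift _ => gk.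
  have := Hpoisson y; have := Hgap y; rewrite (transfer_drift d d0) => gap pois.
  set a := H _ - H _ in gap *.
  have : lam * 2 <= (d y - d0 y) * a.
    apply: ler_pM => //; lra.
  lra.
have : - martingale H m x >= D.
  have := HC x; have := HC (iter m past_shift x).
  rewrite !ler_norml => /andP[c1 c2] /andP[c3 c4]; rewrite /D.
  lra.
move=> MD; rewrite -[1%:R]addr0 lerD //.
rewrite mulrC ler_pdivlMr ?exprn_gt0 // mul1r -[X in _ <= X]sqrrN.
by rewrite lerXn2r // ?nnegrE ltW // (lt_le_trans D0).
Qed.

End Window.
(** * Majority votes and the drift of the model *)

Section Votes.
Variable R : realType.

Definition vote k (x : past) : R := 1 - 2 * fail R k x.

Lemma vote_bounded k : bounded_by 1 (vote k).
Proof.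
move=> x; rewrite /vote /fail; case: (_ <= 0) => /=.
  by rewrite (_ : 1 - _ = -1) ?normrN1 //; lra.
by rewrite mulr0 subr0 normr1.
Qed.

Lemma vote_local k : local k (vote k).
Proof.
move=> x y xy; rewrite /vote /fail.
by under eq_bigr => i _ do rewrite xy //.
Qed.

Lemma vote_increasing k : increasing (vote k).
Proof.
move=> x y xy; rewrite /vote lerD2l lerN2 ler_wpM2l // /fail.
have le_sum : \sum_(i < k) sgn R (x i) <= \sum_(i < k) sgn R (y i).
  by apply: ler_sum => i _; exact/sgn_increasing/xy.
case: (leP (\sum_(i < k) sgn R (y i)) 0) => [y0|_]; last by rewrite ler0n.
by rewrite (le_trans le_sum y0).
Qed.

(** Parity: a sum of [k] signs is congruent to [k] modulo 2. *)
Lemma sum_sgn_neq0 k x : odd k -> \sum_(i < k) sgn R (x i) != 0.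
Proof.
move=> ok; rewrite (eq_bigr (fun i : 'I_k => 2 * (x i)%:R - 1)); last first.
  by move=> i _; rewrite /sgn; case: (x i) => //=; ring.
rewrite sumrB -mulr_sumr -natr_sum sumr_const card_ord -natrM subr_eq0.
rewrite eqr_nat; apply: contraL ok => /eqP <-.
by rewrite mul2n odd_double.
Qed.

Lemma vote_odd k : odd k -> odd_fun (vote k).
Proof.
move=> ok x; rewrite /vote /fail /flip; under eq_bigr do rewrite sgn_negb.
rewrite sumrN oppr_le0; have := sum_sgn_neq0 x ok.
by case: ltgtP => //= _ _; ring.
Qed.

Definition weight j : R := 1 / 2 * (2 / 3) ^+ j.

Lemma weight_gt0 j : 0 < weight j.
Proof. by rewrite mulr_gt0 ?exprn_gt0 //; lra. Qed.

Lemma sum_weight k N : (k <= N)%N ->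
  \sum_(k.+1 <= j < N.+1) weight j = (2 / 3) ^+ k - (2 / 3) ^+ N.
Proof.
elim: N => [|N IH]; first by rewrite leqn0 => /eqP ->; rewrite big_geq ?subrr.
rewrite leq_eqVlt => /predU1P[->|kN]; first by rewrite big_geq ?subrr.
by rewrite big_nat_recr //= IH // /weight exprS; field.
Qed.

Variable m : nat -> nat.

Definition drift N (x : past) : R :=
  1 / 2 * \sum_(1 <= j < N.+1) weight j * vote (m j) x.

Lemma drift_bounded N : bounded_by (1 / 2 * (1 - (2 / 3) ^+ N)) (drift N).
Proof.
move=> x; rewrite /drift normrM ger0_norm ?ler_pM2l //; [|lra..].
rewrite -[1 in leRHS](expr0 (2 / 3)) -sum_weight //.
apply: le_trans (ler_norm_sum _ _ _) _; apply: ler_sum => j _.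
rewrite normrM ger0_norm ?(ltW (weight_gt0 _)) // ler_piMr //.
  exact/ltW/weight_gt0.
exact: vote_bounded.
Qed.

Lemma drift_bounded_half N : bounded_by (1 / 2) (drift N).
Proof.
move=> x; apply: le_trans (drift_bounded N x) _.
have : 0 <= (2 / 3 : R) ^+ N by rewrite exprn_ge0.
lra.
Qed.

Lemma drift_increasing N : increasing (drift N).
Proof.
move=> x y xy; rewrite /drift ler_wpM2l //.
apply: ler_sum => j _; rewrite ler_wpM2l ?(ltW (weight_gt0 _)) //.
exact: vote_increasing.
Qed.

Lemma drift_odd N : (forall j, (0 < j)%N -> odd (m j)) -> odd_fun (drift N).
Proof.
move=> mo x; rewrite /drift -mulrN -sumrN; congr (_ * _).
rewrite !big_nat; apply: eq_bigr => j /andP[j0 _].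
by rewrite vote_odd ?mo // mulrN.
Qed.

Lemma drift_local N n : (forall j, (0 < j <= N)%N -> (m j <= n)%N) ->
  local n (drift N).
Proof.
move=> mn x y xy; rewrite /drift; congr (_ * _).
rewrite !big_nat; apply: eq_bigr => j jN; congr (_ * _).
by apply: vote_local => i im; apply: xy; apply: leq_trans im (mn _ jN).
Qed.

(** The drift of the chain whose levels above [N] vote +1 whatever the past:
their total weight is [(2 / 3) ^+ N]. *)
Definition plus_drift N (x : past) : R := drift N x + 1 / 2 * (2 / 3) ^+ N.

Lemma plus_drift_bounded N : bounded_by 1 (plus_drift N).
Proof.
move=> x; have := drift_bounded N x; rewrite !ler_norml /plus_drift.
have : 0 <= (2 / 3 : R) ^+ N by rewrite exprn_ge0.
by move=> h /andP[h1 h2]; apply/andP; split; lra.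
Qed.

(** The weight of the levels above [k.+1] is twice the weight of level [k.+1].
When they all vote +1 they outweigh level [k.+1], whatever its vote. The sum of
failures is an integer, so being less than 1 means that all of them vote +1. *)
Lemma plus_drift_good k N x : (k < N)%N ->
  \sum_(k.+2 <= j < N.+1) fail R (m j) x < 1 ->
  drift k x + weight k.+1 / 2 <= plus_drift N x.
Proof.
move=> kN few; have nofail j : (k.+1 < j <= N)%N -> fail R (m j) x = 0.
  move=> /andP[kj jN]; move: few.
  rewrite (big_cat_nat (n := j)) ?(leq_trans jN) //= [\sum_(j <= _ < _) _]big_ltn //.
  have h1 : 0 <= \sum_(k.+2 <= i < j) fail R (m i) x.
    by apply: sumr_ge0 => i _; exact: fail_ge0.
  have h2 : 0 <= \sum_(j.+1 <= i < N.+1) fail R (m i) x.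
    by apply: sumr_ge0 => i _; exact: fail_ge0.
  set f := fail R (m j) x; have : f = 0 \/ f = 1.
    by rewrite /f /fail; case: (_ <= 0); [right|left].
  move=> [//|->]. lra.
rewrite /plus_drift /drift [in leRHS](big_cat_nat (n := k.+1)) //=;
  last exact: leqW.
rewrite mulrDr -addrA lerD2l [in leRHS]big_ltn // (_ : \sum_(k.+2 <= j < N.+1) _ =
    \sum_(k.+2 <= j < N.+1) weight j); last first.
  rewrite !big_nat; apply: eq_bigr => j jN.
  by rewrite /vote nofail // mulr0 subr0 mulr1.
rewrite sum_weight //.
have : - weight k.+1 <= weight k.+1 * vote (m k.+1) x.
  rewrite -mulrN1 ler_pM2l ?weight_gt0 //.
  by have := vote_bounded (m k.+1) x; rewrite ler_norml => /andP[].
by rewrite /weight; lra.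
Qed.

End Votes.
(** * Failures are rare at every level *)

Section Estimate.
Variable R : realType.

Lemma exp4_ge M : (8 <= M)%N -> (128 * M ^ 2 <= 4 ^ M)%N.
Proof.
elim: M => // M IH; rewrite leq_eqVlt => /predU1P[<- //|]; rewrite ltnS => M8.
have := IH M8; rewrite [(4 ^ M.+1)%N]expnS; nia.
Qed.

(** The arithmetic of the Chebyshev bound at a level of weight [w] and window
[X], when the lower levels have memory [M] and so [C] bounds the Poisson
solution; [w / 2] is the push and [w / 8] the error allowed in the Poisson
equation. The hypothesis gives [16 * C <= X * w], whence [D >= X * w / 4]. *)
Lemma chebyshev_constant M (X w : R) : (8 <= M)%N -> 0 < w <= 1 ->
  32 * M%:R ^+ 2 * 64 ^+ M <= X * w ^+ 2 ->
  let C := M%:R * 4 ^+ M in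
  let D := X * (w / 2 - w / 8) - 2 * C in
  0 < D /\ X * C ^+ 2 / D ^+ 2 <= 1 / 2 * 4^-1 ^+ M.
Proof.
move=> M8 /andP[w0 w1] XM C D.
have M1 : 1 <= M%:R :> R by rewrite ler1n (leq_trans _ M8).
have a1 : 1 <= 4 ^+ M :> R by rewrite exprn_ege1 //; lra.
have a64 : 64 ^+ M = 4 ^+ M * (4 ^+ M * 4 ^+ M) :> R.
  by rewrite -!exprMn; congr (_ ^+ _); ring.
have -> : 4^-1 ^+ M = (4 ^+ M)^-1 :> R by rewrite exprVn.
rewrite {}a64 in XM; rewrite {}/D {}/C.
set a := 4 ^+ M in a1 XM *; set n := M%:R in M1 XM *.
have na : n * a <= n ^+ 2 * (a * (a * a)).
  have h1 : n * 1 <= n * n by rewrite ler_wpM2l //; lra.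
  have h2 : a * 1 <= a * (a * a).
    rewrite ler_wpM2l //; first lra.
    by rewrite -[1]mulr1 ler_pM //; lra.
  by rewrite expr2; apply: ler_pM; lra.
have na1 : 1 <= n * a by rewrite -[1]mulr1 ler_pM //; lra.
have X0 : 0 < X.
  rewrite -(pmulr_lgt0 _ (exprn_gt0 2 w0)); apply: lt_le_trans XM.
  rewrite -mulrA; lra.
have Xw : 32 * (n * a) <= X * w.
  apply: (@le_trans _ _ (X * w ^+ 2)).
    by apply: le_trans XM; rewrite -mulrA ler_wpM2l //; lra.
  by rewrite expr2 mulrA ler_piMr // mulr_ge0 // ltW.
set D := X * _ - _.
have DX : X * w / 4 <= D by rewrite /D; lra.
have D0 : 0 < D by apply: lt_le_trans DX; lra.
split=> //; rewrite ler_pdivrMr ?exprn_gt0 //.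
apply: (@le_trans _ _ (1 / 2 * a^-1 * (X * w / 4) ^+ 2)); last first.
  have ai : 0 <= 1 / 2 * a^-1 by apply: mulr_ge0; rewrite ?invr_ge0; lra.
  rewrite (ler_wpM2l ai) // lerXn2r // ?nnegrE; lra.
have -> : 1 / 2 * a^-1 * (X * w / 4) ^+ 2 = X * (a^-1 / 32 * (X * w ^+ 2)).
  by field; lra.
rewrite ler_wpM2l ?(ltW X0) //.
have -> : (n * a) ^+ 2 = a^-1 / 32 * (32 * n ^+ 2 * (a * (a * a))).
  by field; lra.
have ai : 0 <= a^-1 / 32 by apply: mulr_ge0; rewrite ?invr_ge0; lra.
exact: ler_wpM2l.
Qed.

Variables (c : nat) (m : nat -> nat).
Hypotheses (c_odd : odd c) (m1 : m 1%N = 217%N)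
  (mS : forall j : nat, (1 <= j)%N -> m j.+1 = (c ^ m j)%N)
  (c_ge : (577 <= c)%N).

Lemma m_odd j : (0 < j)%N -> odd (m j).
Proof.
case: j => // j _; elim: j => [|j IH]; first by rewrite m1.
by rewrite mS // oddX c_odd orbT.
Qed.

Lemma m_ltS j : (0 < j)%N -> (m j < m j.+1)%N.
Proof. by move=> j0; rewrite mS // ltn_expl // (leq_trans _ c_ge). Qed.

Lemma m_ge j : (0 < j)%N -> (216 + j <= m j)%N.
Proof.
case: j => // j _; elim: j => [|j IH]; first by rewrite m1.
by rewrite addnS; apply: leq_ltn_trans IH (m_ltS _).
Qed.

Lemma m_mono i j : (0 < i <= j)%N -> (m i <= m j)%N.
Proof.
case/andP=> i0; elim: j => [|j IH]; first by rewrite leqn0 => /eqP ->.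
rewrite leq_eqVlt => /predU1P[->//|]; rewrite ltnS => ij.
by apply: leq_trans (IH ij) (ltnW (m_ltS _)); apply: leq_trans i0 ij.
Qed.

(** This is where the growth of the windows is used: with [M = m j] and
[j.+1 <= M], the right side is at least [577 ^ M * (4 / 9) ^ M / 4], and
[576 * 4 / 9 = 256] leaves over [64 ^ M] a factor [4 ^ M], which absorbs
[128 * M ^ 2]. *)
Lemma weight_window j : (0 < j)%N ->
  32 * (m j)%:R ^+ 2 * 64 ^+ m j <= (m j.+1)%:R * weight R j.+1 ^+ 2.
Proof.
move=> j0; set M := m j.
have M_ge : (216 + j <= M)%N := m_ge j0.
have cM : 576 ^+ M <= (m j.+1)%:R :> R.
  rewrite (mS j0) -/M natrX; apply: lerXn2r; rewrite ?nnegrE; [exact: ler0n..|].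
  by rewrite ler_nat; exact: ltnW.
have wM : (1 / 2 * (2 / 3) ^+ M) ^+ 2 <= weight R j.+1 ^+ 2.
  rewrite lerXn2r ?nnegrE ?mulr_ge0 ?exprn_ge0 //; try lra.
  rewrite /weight ler_wpM2l //; apply: ler_wiXn2l; [lra|lra|lia].
apply: (@le_trans _ _ (576 ^+ M * (1 / 2 * (2 / 3) ^+ M) ^+ 2)); last first.
  exact: ler_pM (exprn_ge0 _ (ler0n _ _)) (sqr_ge0 _) cM wM.
have -> : 576 ^+ M * (1 / 2 * (2 / 3) ^+ M) ^+ 2 = 1 / 4 * (4 ^+ M * 64 ^+ M) :> R.
  by rewrite exprMn mulrCA -exprM mulnC exprM -!exprMn; congr (_ * _ ^+ _); field.
have /exp4_ge : (8 <= M)%N by apply: leq_trans M_ge.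
rewrite -(ler_nat R) natrM !natrX => h.
have h64 : 0 <= 64 ^+ M :> R by rewrite exprn_ge0.
have := ler_wpM2r h64 h; lra.
Qed.

Variables (N : nat) (L : (past -> R) -> R).
Hypotheses (mL : is_mean L) (sL : stationary (plus_drift R m N) L).

Let f j := L (fail R (m j)).

Let f_ge0 j : 0 <= f j.
Proof.
by apply: (mean_ge0 mL) => [|x]; [exact: bounded_fail|exact: fail_ge0].
Qed.

Let u k := \sum_(k.+1 <= j < N.+1) f j.

Let bad k (x : past) := \sum_(k.+1 <= j < N.+1) fail R (m j) x.

Let bounded_bad k : bounded_fun (bad k).
Proof. by apply: bounded_sum => j; exact: bounded_fail. Qed.

Let bad_ge0 k x : 0 <= bad k x.
Proof. by apply: sumr_ge0 => j _; exact: fail_ge0. Qed.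

Let mean_bad k : L (bad k) = u k.
Proof. by rewrite mean_sum // => j; exact: bounded_fail. Qed.

(** At the first level there is no lower vote: the reference chain is a fair
coin, its Poisson equation is solved by the present spin itself, and the push is
1/6. The constant is [217 / (217 / 6 - 2) ^ 2], rounded up. *)
Lemma first_level_rare : (1 <= N)%N -> f 1 <= 19 / 100 + 217 * u 1.
Proof.
move=> N1; pose d0 (x : past) : R := drift R m 0 x.
have d00 x : d0 x = 0 by rewrite /d0 /drift big_geq // mulr0.
have D0 : 0 < 217 * (weight R 1 / 2 - 0) - 2 * 1 by rewrite /weight expr1; lra.
rewrite /f m1.
have W := @window_bound R (plus_drift R m N) L (plus_drift_bounded R m N) mL
  sL d0 (fun x => sgn R (x 0%N)) (bad 1) 1 0 (weight R 1 / 2) 217 _ (@spin0_bounded R)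
  _ _ (bounded_bad 1) (bad_ge0 1) _ D0.
apply: le_trans (W _ _ _ _) _.
- by rewrite divr_ge0 // ltW // weight_gt0.
- by move=> x; rewrite /sgn /=; lra.
- by move=> x; rewrite transfer_sgn d00; lra.
- by move=> x; exact: plus_drift_good.
- rewrite mean_bad lerD2r ler_pdivrMr ?exprn_gt0 // /weight expr1 expr1n.
  lra.
Qed.

(** The reference chain keeps only the levels up to [j], which are symmetric
under the flip and look at [m j] spins. *)
Lemma next_level_rare j : (0 < j < N)%N ->
  f j.+1 <= 1 / 2 * 4^-1 ^+ m j + (m j.+1)%:R * u j.+1.
Proof.
move=> /andP[j0 jN].
have M8 : (8 <= m j)%N by apply: leq_trans (m_ge j0).
have w0 := weight_gt0 R j.+1.
have w1 : weight R j.+1 <= 1.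
  rewrite /weight; have : (2 / 3 : R) ^+ j.+1 <= 1 by rewrite exprn_ile1 //; lra.
  lra.
have [|D0 DC] := chebyshev_constant M8 _ (weight_window j0); first by rewrite w0.
have [||||H [HC Hgap HP]] := @poisson_solution R (drift R m j) (m j)
    (drift_bounded_half R m j) (@drift_increasing R m j) _ _ _ (weight R j.+1 / 8).
- by apply: drift_odd; exact: m_odd.
- by apply: drift_local => i /andP[i0 ij]; rewrite m_mono // i0.
- exact: leq_trans M8.
- lra.
apply: le_trans (@window_bound R (plus_drift R m N) L (plus_drift_bounded R m N) mL
  sL (drift R m j) H (bad j.+1) _ _ (weight R j.+1 / 2) (m j.+1) _ HC Hgap HP
  (bounded_bad _) (bad_ge0 _) _ D0) _; first lra.
  by move=> x; exact: plus_drift_good.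
by rewrite mean_bad lerD2r.
Qed.

(** Downward recursion on the level, starting from the empty tail at [N]. The
union bound costs a factor [m k.+1], absorbed by [4 ^ - m k.+1] because [m k.+1]
is at least twice [m k]. *)
Lemma tail_rare k : (0 < k <= N)%N -> u k <= 2 * 4^-1 ^+ m k.
Proof.
move=> /andP[]; have [i iE] : exists i, i = (N - k)%N by exists (N - k)%N.
elim: i k iE => [|i IH] k iE k0 kN.
  have -> : k = N by lia.
  by rewrite /u big_geq // mulr_ge0 // exprn_ge0 // invr_ge0.
have kN' : (k < N)%N by lia.
have uS : u k = f k.+1 + u k.+1 by rewrite /u big_ltn.
have IHk : u k.+1 <= 2 * 4^-1 ^+ m k.+1 by apply: IH => //; lia.
have fk : f k.+1 <= 1 / 2 * 4^-1 ^+ m k + (m k.+1)%:R * u k.+1.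
  by apply: next_level_rare; rewrite k0.
set M := m k in fk *; set M' := m k.+1 in IHk fk.
have MM' : (2 * M <= M')%N.
  rewrite /M' mS // -/M; apply: (@leq_trans (2 ^ M)).
    by case: (M) => // n; rewrite expnS leq_mul2l ltn_expl.
  by rewrite leq_exp2r ?(leq_trans _ c_ge) // (leq_trans _ (m_ge k0)).
have M'2 : (2 * (M' + 1) <= 2 ^ M')%N.
  have : (3 <= M')%N by apply: leq_trans (m_ge (ltn0Sn k)).
  elim: (M') => // n IHn; rewrite leq_eqVlt => /predU1P[<-//|].
  by rewrite ltnS => /IHn; rewrite expnS; lia.
have small : (M'%:R + 1) * (2 * 4^-1 ^+ M') <= 4^-1 ^+ M :> R.
  have -> : 4^-1 ^+ M' = 2^-1 ^+ M' * 2^-1 ^+ M' :> R.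
    by rewrite -exprMn; congr (_ ^+ _); field.
  have h : 2^-1 ^+ M' <= 4^-1 ^+ M :> R.
    have -> : 4^-1 = 2^-1 ^+ 2 :> R by field.
    by rewrite -exprM; apply: ler_wiXn2l => //; lra.
  apply: le_trans h; move: M'2; rewrite -(ler_nat R) natrM natrX natrD => h.
  have p0 : 0 < 2^-1 ^+ M' :> R by rewrite exprn_gt0 // invr_gt0.
  have p1 : 2 ^+ M' * 2^-1 ^+ M' = 1 :> R by rewrite -exprMn divff // expr1n.
  have := ler_wpM2r (ltW p0) h; rewrite p1 => h1.
  by have := ler_wpM2r (ltW p0) h1; rewrite mul1r; lra.
have M0 : 0 <= M'%:R + 1 :> R by rewrite addr_ge0.
have := ler_wpM2l M0 IHk; rewrite uS.
have : 0 <= 4^-1 ^+ M :> R by rewrite exprn_ge0 // invr_ge0.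
lra.
Qed.

(** The mean of the present spin is the mean drift, which is
[1 / 2] minus the weighted sum of the failure probabilities. *)
Lemma mean_spin_ge : (1 <= N)%N -> 1 / 4 <= L (fun x => sgn R (x 0%N)).
Proof.
move=> N1.
have u1 : u 1 <= 2 * (256^-1 * 256^-1).
  apply: le_trans (tail_rare _) _; first by rewrite N1.
  rewrite m1 ler_wpM2l // (_ : 256^-1 * 256^-1 = 4^-1 ^+ 8); last by field.
  by apply: ler_wiXn2l => //; lra.
have u0 : u 0 = f 1 + u 1 by rewrite /u big_ltn.
have u1_ge0 : 0 <= u 1 by apply: sumr_ge0.
have f1 := first_level_rare N1.
have bs : bounded_fun (fun x : past => sgn R (x 0%N)).
  by exists 1; exact: spin0_bounded.
rewrite -sL // (_ : transfer _ _ = plus_drift R m N); last first.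
  by apply/funext => x; rewrite transfer_sgn.
have bw j : bounded_fun (fun x => weight R j * fail R (m j) x).
  by apply: boundedM; [exact: bounded_const|exact: bounded_fail].
pose W (x : past) := \sum_(1 <= j < N.+1) weight R j * fail R (m j) x.
have bW : bounded_fun W by apply: bounded_sum.
have -> : plus_drift R m N = fun x => 1 / 2 - W x.
  apply/funext => x; rewrite /plus_drift /drift /vote.
  have -> : \sum_(1 <= j < N.+1) weight R j * (1 - 2 * fail R (m j) x) =
      \sum_(1 <= j < N.+1) weight R j - 2 * W x.
    rewrite /W mulr_sumr -sumrB; apply: eq_bigr => j _; ring.
  by rewrite sum_weight // expr0; field.
rewrite meanB //; last exact: bounded_const.
rewrite mean_cst //.
have : L W <= u 0.
  rewrite /W mean_sum // /u; apply: ler_sum => j _.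
  rewrite meanZ //; last exact: bounded_fail.
  rewrite ler_piMl //; first exact: f_ge0.
  rewrite /weight; have : (2 / 3 : R) ^+ j <= 1 by rewrite exprn_ile1 //; lra.
  lra.
lra.
Qed.

End Estimate.
(** * Letting all the levels vote *)

Section LimitDrift.
Variables (R : realType) (m : nat -> nat).

Definition limit_drift (x : past) : R := limn (fun N => drift R m N x).

Let geom_cvg0 : (fun N => 1 / 2 * (2 / 3) ^+ N : R) @ \oo --> 0.
Proof.
rewrite -[X in _ --> X](mulr0 (1 / 2)); apply: cvgMl_tmp.
by apply: cvg_expr; rewrite ger0_norm; lra.
Qed.

Lemma driftS N x : drift R m N.+1 x = drift R m N x
  + 1 / 2 * (weight R N.+1 * vote R (m N.+1) x).
Proof. by rewrite /drift big_nat_recr //= mulrDr. Qed.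

Let vote_step N x : `|weight R N.+1 * vote R (m N.+1) x| <= 1 / 3 * (2 / 3) ^+ N.
Proof.
have -> : 1 / 3 * (2 / 3) ^+ N = weight R N.+1 by rewrite /weight exprS; field.
rewrite normrM ger0_norm ?(ltW (weight_gt0 _ _)) // ler_piMr //.
  exact/ltW/weight_gt0.
exact: vote_bounded.
Qed.

(* The truncated drifts with all higher votes set to +1, respectively -1,
   are monotone in N and squeeze the limit. *)
Let plus_drift_noninc x : nonincreasing_seq (fun N => plus_drift R m N x).
Proof.
apply/nonincreasing_seqP => N; rewrite /plus_drift driftS.
by have := vote_step N x; rewrite ler_norml exprS => /andP[_]; lra.
Qed.

Let minus_drift_nondec x :
  nondecreasing_seq (fun N => drift R m N x - 1 / 2 * (2 / 3) ^+ N).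
Proof.
apply/nondecreasing_seqP => N; rewrite driftS.
by have := vote_step N x; rewrite ler_norml exprS => /andP[+ _]; lra.
Qed.

Lemma drift_cvg x : drift R m N x @[N --> \oo] --> limit_drift x.
Proof.
have : cvgn (fun N => plus_drift R m N x).
  apply: nonincreasing_is_cvgn; first exact: plus_drift_noninc.
  exists (-1) => _ [N _ <-].
  by have := plus_drift_bounded R m N x; rewrite ler_norml => /andP[].
move=> /cvg_ex[l plusl]; suff : drift R m N x @[N --> \oo] --> l.
  by move=> h; apply/cvg_ex; exists l.
rewrite -[l]subr0 (_ : (fun N => _) =
    (fun N => plus_drift R m N x - 1 / 2 * (2 / 3) ^+ N)); last first.
  by apply/funext => N; rewrite addrK.
exact: cvgB.
Qed.

Lemma limit_drift_dist N x :
  `|limit_drift x - drift R m N x| <= 1 / 2 * (2 / 3) ^+ N.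
Proof.
have cplus : plus_drift R m N x @[N --> \oo] --> limit_drift x.
  by rewrite -[limit_drift x]addr0; apply: cvgD => //; exact: drift_cvg.
have cminus : drift R m N x - 1 / 2 * (2 / 3) ^+ N @[N --> \oo] --> limit_drift x.
  by rewrite -[limit_drift x]subr0; apply: cvgB => //; exact: drift_cvg.
rewrite ler_norml; apply/andP; split.
- have := nondecreasing_cvgn_le (@minus_drift_nondec x) _ N.
  rewrite (cvg_lim _ cminus) // => /(_ cminus); lra.
- have := nonincreasing_cvgn_ge (@plus_drift_noninc x) _ N.
  rewrite (cvg_lim _ cplus) // => /(_ cplus); rewrite /plus_drift; lra.
Qed.

Lemma limit_drift_bounded : bounded_by (1 / 2) limit_drift.
Proof.
move=> x; have := limit_drift_dist 0 x.
by rewrite /drift big_geq // mulr0 subr0 expr0 mulr1.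
Qed.

Lemma limit_drift_odd : (forall j, (0 < j)%N -> odd (m j)) -> odd_fun limit_drift.
Proof.
move=> mo x; apply: cvg_lim => //.
rewrite (_ : (fun N => _) = (fun N => - drift R m N x)); last first.
  by apply/funext => N; rewrite drift_odd.
by apply: cvgN; exact: drift_cvg.
Qed.

Lemma limit_drift_unif : uniformly_local limit_drift.
Proof.
move=> e e0; have /cvgrPdist_le := geom_cvg0.
have e2 : 0 < e / 2 by rewrite divr_gt0.
move=> /(_ _ e2)[N _ /(_ N (leqnn N))]; rewrite sub0r normrN => hN.
have {}hN := le_trans (ler_norm _) hN.
exists (\max_(j < N.+1) m j)%N => x y xy.
have dxy : drift R m N x = drift R m N y.
  apply: (@drift_local R m N _ _ x y xy) => j /andP[_ jN].
  exact: (leq_bigmax (Ordinal (jN : (j < N.+1)%N))).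
have := limit_drift_dist N x; have := limit_drift_dist N y.
by rewrite dxy !ler_norml => /andP[? ?] /andP[? ?]; apply/andP; split; lra.
Qed.

(** The lower bound on the mean spin is uniform in the truncation level, and the
truncated drifts converge uniformly, so a generalized limit of the truncated
stationary means is stationary for the full model and still biased. *)
Lemma limit_mean (c : nat) : odd c -> m 1%N = 217%N ->
  (forall j : nat, (1 <= j)%N -> m j.+1 = (c ^ m j)%N) -> (577 <= c)%N ->
  exists L, [/\ is_mean L, stationary limit_drift L &
    1 / 4 <= L (fun x => sgn R (x 0%N))].
Proof.
move=> c_odd m1 mS c_ge.
have /choice[Ls LsP] N := exists_stationary (plus_drift_bounded R m N.+1).
have mLs N : is_mean (Ls N) by case: (LsP N).
have sLs N : stationary (plus_drift R m N.+1) (Ls N) by case: (LsP N).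
have [Lim [mLim LimP]] := generalized_limit R.
have mL := mean_family_limit mLim mLs.
have ld1 : bounded_by 1 limit_drift.
  by move=> x; apply: le_trans (limit_drift_bounded x) _; lra.
have bs : bounded_fun (fun x : past => sgn R (x 0%N)).
  by exists 1; exact: spin0_bounded.
have bLs F : bounded_fun F -> bounded_fun (fun N => Ls N F).
  by move=> [B FB]; exists B => N; exact: mean_bounded.
exists (fun F => Lim (fun N => Ls N F)); split=> //; last first.
  rewrite -[1 / 4](mean_cst mLim); apply: mean_le => // [||N].
  - exact: bounded_const.
  - exact: bLs.
  - exact: (mean_spin_ge c_odd m1 mS c_ge (mLs N) (sLs N)).
move=> F [B FB]; have bF : bounded_fun F by exists B.
have bdF := bounded_transfer ld1 bF.
apply/eqP; rewrite -subr_eq0 -(meanB mLim (bLs _ bdF) (bLs _ bF)).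
apply/eqP/(generalized_limit_small mLim LimP).
  exact: boundedB (bLs _ bdF) (bLs _ bF).
move=> e e0; have /cvgrPdist_le : (fun N => 2 * B * (1 / 2 * (2 / 3) ^+ N)) @ \oo --> (0 : R).
  by rewrite -[X in _ --> X](mulr0 (2 * B)); apply: cvgMl_tmp.
move=> /(_ _ e0); apply: filterS => N; rewrite sub0r normrN => hN.
have bpF := bounded_transfer (plus_drift_bounded R m N.+1) bF.
rewrite -(sLs N F bF) -meanB //; apply: mean_bounded => // x.
rewrite (transfer_drift _ (plus_drift R m N.+1)) addrAC subrr add0r normrM.
rewrite mulrC; apply: le_trans (le_trans (ler_norm _) hN).
have B2 : `|F (past_cons true x) - F (past_cons false x)| <= 2 * B.
  by apply: le_trans (ler_normB _ _) _; rewrite mulr2n mulrDl mul1r lerD.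
apply: ler_pM => //.
rewrite normrM [`|2^-1|]ger0_norm ?invr_ge0 // /plus_drift opprD addrA.
have p0 : 0 <= (2 / 3 : R) ^+ N by rewrite exprn_ge0.
have := limit_drift_dist N.+1 x; rewrite exprS !ler_norml => /andP[h1 h2].
have : `|limit_drift x - drift R m N.+1 x - 1 / 2 * (2 / 3 * (2 / 3) ^+ N)|
    <= 2 / 3 * (2 / 3) ^+ N.
  by rewrite ler_norml; apply/andP; split; lra.
lra.
Qed.

End LimitDrift.
(** * The Borel sets of pasts are generated by cylinders *)

Section Cylinders.

Definition cyl (s : seq bool) : set past := [set x | mkseq x (size s) = s].

Lemma mkseqP (x y : past) n :
  mkseq x n = mkseq y n <-> (forall i, (i < n)%N -> x i = y i).
Proof.
split=> [e i ilt|e].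
  by rewrite -(nth_mkseq false x ilt) e nth_mkseq.
apply: (@eq_from_nth _ false); rewrite ?size_mkseq // => i ilt.
by rewrite !nth_mkseq // e.
Qed.

Lemma cyl_mkseq x n : cyl (mkseq x n) x.
Proof. by rewrite /cyl /mkset size_mkseq. Qed.

Lemma cyl_mkseqP (x y : past) n :
  cyl (mkseq x n) y <-> (forall i, (i < n)%N -> y i = x i).
Proof. by rewrite -mkseqP; split; rewrite /cyl /mkset size_mkseq. Qed.

Lemma mkseq_cons a (x : past) n : mkseq (past_cons a x) n.+1 = a :: mkseq x n.
Proof.
by rewrite /mkseq /= (iotaDl 1 0) -map_comp.
Qed.

Lemma cyl_cons a s x : cyl (a :: s) x <-> x 0%N = a /\ cyl s (past_shift x).
Proof.
have {1}-> : x = past_cons (x 0%N) (past_shift x) by apply/funext => -[].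
by rewrite /cyl /= -/(mkseq _ _) (mkseq_cons (x 0%N)); split=> [[<- ->]|[-> ->]].
Qed.

Lemma nbhs_cyl (x : past) n : nbhs x (cyl (mkseq x n)).
Proof.
have coord i : nbhs x [set y : past | y i = x i].
  apply: (@proj_continuous nat (fun=> bool) i x [set x i]).
  exact: discrete_set1.
elim: n => [|n IH]; first by apply: filterS filterT.
apply: filterS (filterI IH (coord n)) => y [].
move=> /cyl_mkseqP yx yn; apply/cyl_mkseqP => i.
by rewrite ltnS leq_eqVlt => /predU1P[->|/yx].
Qed.

(** The filter of cylinders around [x] converges to [x] coordinatewise, hence in
the product topology. *)
Lemma nbhs_past_cyl (x : past) (U : set past) : nbhs x U ->
  exists n, cyl (mkseq x n) `<=` U.
Proof.
pose F := filter_from [set: nat] (fun n => cyl (mkseq x n)).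
have cylS n k : (n <= k)%N -> cyl (mkseq x k) `<=` cyl (mkseq x n).
  move=> nk y /cyl_mkseqP xy.
  by apply/cyl_mkseqP => i ilt; apply: xy; apply: leq_trans ilt nk.
have FF : Filter F.
  apply: filter_from_filter; first by exists 0%N.
  move=> i j _ _; exists (maxn i j) => // y cy.
  by split; apply: cylS cy; rewrite (leq_maxl, leq_maxr).
have Fx : F --> x.
  apply/cvg_sup => i A /= [_ [[C oC <-] Cx sCA]].
  exists i.+1 => // y /cyl_mkseqP /(_ i (ltnSn i)) yx.
  by apply: sCA; rewrite /= yx.
by move=> /Fx [n _ sub]; exists n.
Qed.

Lemma cyl_open s : open (cyl s).
Proof.
rewrite openE => x cx; have := nbhs_cyl x (size s).
by rewrite [mkseq _ _]cx.
Qed.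

Lemma cyl_nested s t : (size s <= size t)%N ->
  cyl s `&` cyl t = cyl t \/ cyl s `&` cyl t = set0.
Proof.
move=> st; have [e|ne] := eqVneq (take (size s) t) s; [left|right].
  apply/seteqP; split=> [x []//|x cx]; split=> //.
  rewrite /cyl /= -[in RHS]e -[in RHS](_ : mkseq x (size t) = t) //.
  apply: (@eq_from_nth _ false).
    by rewrite size_takel ?size_mkseq.
  rewrite size_mkseq => i ilt; rewrite nth_take // !nth_mkseq //.
  exact: leq_trans ilt st.
rewrite -subset0 => x [cs ct]; move/eqP: ne; apply.
rewrite -[in LHS](_ : mkseq x (size t) = t) // -[in RHS](_ : mkseq x (size s) = s) //.
apply: (@eq_from_nth _ false).
  by rewrite size_takel ?size_mkseq.
rewrite size_takel ?size_mkseq // => i ilt; rewrite nth_take // !nth_mkseq //.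
exact: leq_trans ilt st.
Qed.

(** The empty set is added to make the family stable under intersection. *)
Definition cylinders : set_system past := [set A | A = set0 \/ exists s, A = cyl s].

Lemma setI_cylinders : setI_closed cylinders.
Proof.
move=> A B [->|[s ->]]; first by rewrite set0I; left.
move=> [->|[t ->]]; first by rewrite setI0; left.
wlog st : s t / (size s <= size t)%N.
  move=> h; have [/h//|/ltnW/h] := leqP (size s) (size t).
  by rewrite setIC.
by have [->|->] := cyl_nested st; [right; exists t|left].
Qed.

Lemma borel_past_cylinders : @measurable _ borel_past = <<s cylinders >>.
Proof.
apply/seteqP; split; apply: smallest_sub; try exact: smallest_sigma_algebra.
- move=> U oU; pose I := {s : seq bool | `[< cyl s `<=` U >]}.
  have -> : U = \bigcup_(i : I) cyl (sval i).
    apply/seteqP; split=> [x Ux|x [[s /= /asboolP sU] _]]; last exact: sU.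
    have [n nU] := nbhs_past_cyl (open_nbhs_nbhs (conj oU Ux)).
    by exists (exist _ (mkseq x n) (asboolT nU)) => //; exact: cyl_mkseq.
  apply: (@countable_bigcupT_measurable _ (g_sigma_algebraType cylinders) I
    (fun i => cyl (sval i))); first exact: countableP.
  by move=> i; apply: sub_sigma_algebra; right; exists (sval i).
- move=> _ [->|[s ->]]; first exact: measurable0.
  by apply: sub_sigma_algebra; exact: cyl_open.
Qed.

Lemma measurable_cyl s : @measurable _ borel_past (cyl s).
Proof. by apply: sub_sigma_algebra; exact: cyl_open. Qed.

Lemma borel_past_unique (R : realType)
    (m1 m2 : {measure set borel_past -> \bar R}) :
  (forall s, m1 (cyl s) = m2 (cyl s)) -> (m1 setT < +oo)%E ->
  forall A, measurable A -> m1 A = m2 A.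
Proof.
move=> m12 m1oo A mA.
have cylT : cyl [::] = setT by apply/seteqP; split.
apply: (@measure_unique _ R borel_past cylinders (fun=> setT) borel_past_cylinders setI_cylinders _ _ m1 m2 _ _ _ mA) => //.
- by move=> _; right; exists [::].
- by rewrite bigcup_const.
- by move=> _ [->|[s ->]]; rewrite ?measure0.
Qed.

Lemma measurable_past_shift :
  measurable_fun setT (past_shift : borel_past -> borel_past).
Proof.
apply: (measurability _ borel_past_cylinders) => _ [_ [->|[s ->]] <-].
  by rewrite preimage_set0 setI0; exact: measurable0.
rewrite setTI; have -> : past_shift @^-1` cyl s = cyl (true :: s) `|` cyl (false :: s).
  apply/seteqP; split=> [x xs|x [/cyl_cons[]|/cyl_cons[]]] //.
  by case x0 : (x 0%N); [left|right]; apply/cyl_cons.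
by apply: measurableU; exact: measurable_cyl.
Qed.

Section Continuity.
Variables (R : realType) (g : past -> R).
Hypothesis g_unif : uniformly_local g.

Lemma unif_continuous : continuous g.
Proof.
move=> x; apply/cvgrPdist_le => e /g_unif[n gn].
apply: filterS (nbhs_cyl x n) => y /cyl_mkseqP yx.
by apply: gn => i /yx.
Qed.

Lemma unif_measurable : measurable_fun setT (g : borel_past -> R).
Proof.
apply: (measurability _ (RGenOpens.measurableE R)).
move=> _ [_ [a [b ->] <-]]; rewrite setTI; apply: sub_sigma_algebra.
by apply: open_comp; [move=> x _; exact: unif_continuous|exact: interval_open].
Qed.

End Continuity.
End Cylinders.
(** * A measure with prescribed values on cylinders *)

Section CylinderMeasure.
Variables (R : realType) (w : seq bool -> R).
Hypotheses (w_ge0 : forall s, 0 <= w s) (w_nil : w [::] = 1)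
  (w_split : forall s, w s = w (rcons s true) + w (rcons s false)).

(** The cylinders of length [n] are laid out as consecutive intervals of length
[w s] in [0, 1), the extension by +1 coming first; this is the left end of the
interval of [s], namely the total weight of the words of the same length that
precede it. *)
Definition left_end (s : seq bool) : R :=
  \sum_(i < size s | ~~ nth false s i) w (rcons (take i s) true).

Lemma left_end_rcons s b : left_end (rcons s b) =
  left_end s + (if b then 0 else w (rcons s true)).
Proof.
rewrite /left_end size_rcons big_mkcond big_ord_recr /= nth_rcons ltnn eqxx.
rewrite -cats1 take_size_cat // [in RHS]big_mkcond /=; congr (_ + _); last by case: b.
apply: eq_bigr => i _; rewrite nth_cat ltn_ord take_cat.
by rewrite ltn_ord.
Qed.

Lemma left_end_bounds s : 0 <= left_end s /\ left_end s + w s <= 1.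
Proof.
elim/last_ind: s => [|s b [l0 l1]]; first by rewrite /left_end big_ord0 add0r w_nil.
rewrite left_end_rcons; have := w_split s.
have := w_ge0 (rcons s true); have := w_ge0 (rcons s false).
by case: b; split; lra.
Qed.

(** The address of [u] in this layout, read from the coarsest interval down. *)
Fixpoint digits (u : R) n : seq bool :=
  if n is k.+1 then
    let s := digits u k in rcons s (u < left_end s + w (rcons s true))
  else [::].

Lemma digitsP u s : 0 <= u < 1 ->
  digits u (size s) = s <-> left_end s <= u < left_end s + w s.
Proof.
move=> u01; elim/last_ind: s => [|s b IH].
  by rewrite /left_end big_ord0 add0r w_nil.
rewrite size_rcons /= left_end_rcons.
have := w_split s; have := w_ge0 (rcons s true); have := w_ge0 (rcons s false).
move=> wf wt ws; split.
- move=> /rcons_inj[e]; have /andP[lu ul] := IH.1 e; rewrite e.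
  by case: b; case: ltP => // h _; apply/andP; split; lra.
- have [h|h] := boolP (left_end s <= u < left_end s + w s).
    have -> : digits u (size s) = s by apply/IH.
    move: h => /andP[lu ul].
    by case: b => /andP[h1 h2]; congr rcons; [|apply/negbTE; rewrite -leNgt]; lra.
  move=> hb; case/negP: h; move: hb.
  by case: b => /andP[h1 h2]; apply/andP; split; lra.
Qed.

Definition coding (u : R) : past :=
  fun n => let s := digits u n in u < left_end s + w (rcons s true).

Lemma mkseq_coding u n : mkseq (coding u) n = digits u n.
Proof.
elim: n => // n IH; rewrite [RHS]/= -IH -[n.+1]addn1 /mkseq iotaD map_cat /=.
by rewrite cats1 add0n /coding -IH.
Qed.

Lemma measurable_coding : measurable_fun setT (coding : R -> borel_past).
Proof.
apply: (measurability _ borel_past_cylinders) => _ [_ [->|[s ->]] <-].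
  by rewrite preimage_set0 setI0; exact: measurable0.
rewrite setTI; have -> : coding @^-1` cyl s = [set u | digits u (size s) = s].
  by apply/seteqP; split=> u; rewrite /cyl /preimage /mkset mkseq_coding.
elim/last_ind: s => [|s b IH].
  rewrite (_ : [set _ | _] = setT); first exact: measurableT.
  by apply/seteqP; split.
set t := left_end s + w (rcons s true).
have -> : [set u | digits u (size (rcons s b)) = rcons s b] =
    [set u | digits u (size s) = s] `&`
    (if b then [set` `]-oo, t[] else [set` `[t, +oo[]).
  apply/seteqP; split=> u; rewrite /mkset size_rcons /=.
    move=> /rcons_inj[e]; rewrite e -/t => ub; split=> //.
    by case: b ub => ub; rewrite /= in_itv /= ?ub // andbT leNgt ub.
  move=> [-> ub]; congr rcons; rewrite -/t.
  move: ub; case: b => /=; rewrite in_itv /= ?andbT // => tu.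
  by apply/negbTE; rewrite -leNgt.
by apply: measurableI => //; case: (b).
Qed.

(** The law of the coding of a uniform point of [0, 1). *)
Definition coded_measure (A : set borel_past) : \bar R :=
  lebesgue_measure (coding @^-1` A `&` [set` `[0%R, 1%R[]).

Let coded0 : coded_measure set0 = 0%E.
Proof. by rewrite /coded_measure preimage_set0 set0I measure0. Qed.

Let coded_ge0 A : (0 <= coded_measure A)%E.
Proof. exact: measure_ge0. Qed.

Let coded_sigma : semi_sigma_additive coded_measure.
Proof.
move=> F mF tF mUF; rewrite /coded_measure preimage_bigcup setI_bigcupl.
have mpre (A : set borel_past) : measurable A ->
    measurable (coding @^-1` A `&` [set` `[0%R, 1%R[] : set R).
  move=> mA; apply: measurableI => //.
  by rewrite -[X in measurable X]setTI; exact: measurable_coding.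
apply: measure_semi_sigma_additive.
- by move=> n; exact: mpre.
- apply/trivIsetP => i j _ _ ij; rewrite setIACA setIid -preimage_setI.
  by move/trivIsetP : tF => /(_ _ _ _ _ ij) ->//; rewrite preimage_set0 set0I.
- by rewrite -setI_bigcupl -preimage_bigcup; exact: mpre.
Qed.

HB.instance Definition _ := isMeasure.Build _ _ _ coded_measure
  coded0 coded_ge0 coded_sigma.

Lemma coded_measure_cyl s : coded_measure (cyl s) = (w s)%:E.
Proof.
rewrite /coded_measure; have [l0 l1] := left_end_bounds s.
have -> : coding @^-1` cyl s `&` [set` `[0%R, 1%R[] =
    [set` `[left_end s, left_end s + w s[].
  apply/seteqP; split=> u.
    move=> [e]; rewrite /= !in_itv /= => u01; apply/digitsP => //.
    by rewrite -mkseq_coding.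
  rewrite [X in X -> _]/= in_itv /= => lu; have u01 : 0 <= u < 1.
    by case/andP: lu => h1 h2; apply/andP; split; lra.
  split; last by rewrite /= ?in_itv /=.
  by rewrite /cyl /preimage /mkset mkseq_coding; apply/digitsP.
rewrite lebesgue_measure_itv /= lte_fin.
case: ltP => [_|]; first by rewrite -EFinD; congr EFin; ring.
by have := w_ge0 s => h1 h2; congr EFin; lra.
Qed.

Let coded_setT : coded_measure setT = 1%E.
Proof.
have -> : [set: borel_past] = cyl [::] by apply/seteqP; split.
by rewrite coded_measure_cyl w_nil.
Qed.

HB.instance Definition _ :=
  Measure_isProbability.Build _ _ _ coded_measure coded_setT.

Lemma exists_cylinder_measure :
  exists mu : probability borel_past R, forall s, mu (cyl s) = (w s)%:E.
Proof. by exists coded_measure; exact: coded_measure_cyl. Qed.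

End CylinderMeasure.
(** * From a stationary mean to a g-measure *)

Section ShiftMeasure.
Variables (R : realType) (nu : {measure set borel_past -> \bar R}).

Definition shift_measure (A : set borel_past) : \bar R :=
  nu (past_shift @^-1` A).

Let measurable_preshift (A : set borel_past) :
  measurable A -> measurable (past_shift @^-1` A : set borel_past).
Proof.
by move=> mA; rewrite -[X in measurable X]setTI; exact: measurable_past_shift.
Qed.

Let shift0 : shift_measure set0 = 0%E.
Proof. by rewrite /shift_measure preimage_set0 measure0. Qed.

Let shift_ge0 A : (0 <= shift_measure A)%E.
Proof. exact: measure_ge0. Qed.

Let shift_sigma : semi_sigma_additive shift_measure.
Proof.
move=> F mF tF mUF; rewrite /shift_measure preimage_bigcup.
apply: measure_semi_sigma_additive.
- by move=> n; exact: measurable_preshift.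
- apply/trivIsetP => i j _ _ ij; rewrite -preimage_setI.
  by move/trivIsetP : tF => /(_ _ _ _ _ ij) ->//; rewrite preimage_set0.
- by rewrite -preimage_bigcup; exact: measurable_preshift.
Qed.

HB.instance Definition _ := isMeasure.Build _ _ _ shift_measure
  shift0 shift_ge0 shift_sigma.

End ShiftMeasure.

Section Density.
Variables (R : realType) (mu : {measure set borel_past -> \bar R}).
Variable h : borel_past -> R.
Hypotheses (h_ge0 : forall x, 0 <= h x) (mh : measurable_fun setT h).

Definition density_measure (A : set borel_past) : \bar R :=
  (\int[mu]_(x in A) (h x)%:E)%E.

Let density0 : density_measure set0 = 0%E.
Proof. exact: integral_set0. Qed.

Let density_ge0 A : (0 <= density_measure A)%E.
Proof. by apply: integral_ge0 => x _; rewrite lee_fin. Qed.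

Let density_sigma : semi_sigma_additive density_measure.
Proof.
apply: semi_sigma_additive_nng_induced; last by move=> x; rewrite lee_fin.
exact/measurable_EFinP.
Qed.

HB.instance Definition _ := isMeasure.Build _ _ _ density_measure
  density0 density_ge0 density_sigma.

(** The form in which conditional probabilities given the strict past are
checked: both sides are measures in [A]. *)
Lemma density_unique (nu : {measure set borel_past -> \bar R}) :
  (forall s, nu (past_shift @^-1` cyl s) =
     \int[mu]_(x in past_shift @^-1` cyl s) (h x)%:E)%E ->
  (nu setT < +oo)%E ->
  forall A : set borel_past, measurable A ->
  nu (past_shift @^-1` A) = (\int[mu]_(x in past_shift @^-1` A) (h x)%:E)%E.
Proof.
move=> eq_cyl nu_fin A mA.
have := @borel_past_unique R (shift_measure nu) (shift_measure density_measure).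
by apply.
Qed.

End Density.

Section Realization.
Variables (R : realType) (d : past -> R) (L : (past -> R) -> R).
Hypotheses (d_bounded : bounded_by (1 / 2) d)
  (d_unif : uniformly_local d)
  (mL : is_mean L) (sL : stationary d L).

Let d1 : bounded_by 1 d.
Proof. by move=> x; apply: le_trans (d_bounded x) _; lra. Qed.

Definition cyl_ind s (x : past) : R := (mkseq x (size s) == s)%:R.

Let bounded_ind s : bounded_fun (cyl_ind s).
Proof.
exists 1 => x; rewrite /cyl_ind.
by case: (_ == _); rewrite ?normr1 ?normr0.
Qed.

Definition cyl_weight s : R := L (cyl_ind s).

Lemma cyl_ind_rcons s x :
  cyl_ind s x = cyl_ind (rcons s true) x + cyl_ind (rcons s false) x.
Proof.
rewrite /cyl_ind !size_rcons.
have mk : mkseq x (size s).+1 = rcons (mkseq x (size s)) (x (size s)).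
  by rewrite /mkseq -addn1 iotaD map_cat cats1.
rewrite mk !eqseq_rcons; case: (_ == s) => /=; rewrite ?addr0 //.
by case: (x _) => /=; rewrite ?addr0 ?add0r.
Qed.

Lemma cyl_ind_cons a s b x : cyl_ind (a :: s) (past_cons b x) =
  (b == a)%:R * cyl_ind s x.
Proof. by rewrite /cyl_ind [size _]/= mkseq_cons eqseq_cons -natrM mulnb. Qed.

Lemma cyl_ind_shift s x :
  cyl_ind s (past_shift x) = cyl_ind (true :: s) x + cyl_ind (false :: s) x.
Proof.
have {2 3}-> : x = past_cons (x 0%N) (past_shift x) by apply/funext => -[].
by rewrite !cyl_ind_cons; case: (x 0%N); rewrite /= ?mul1r ?mul0r ?addr0 ?add0r.
Qed.

Lemma cyl_weight_ge0 s : 0 <= cyl_weight s.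
Proof. by apply: (mean_ge0 mL) => // x; exact: ler0n. Qed.

Lemma cyl_weight_nil : cyl_weight [::] = 1.
Proof.
by rewrite -[RHS](mean1 mL); congr L; apply/funext => x; rewrite /cyl_ind eqxx.
Qed.

Lemma cyl_weight_split s :
  cyl_weight s = cyl_weight (rcons s true) + cyl_weight (rcons s false).
Proof.
rewrite /cyl_weight -meanD //; congr L; apply/funext => x.
exact: cyl_ind_rcons.
Qed.

Lemma cyl_weight_le1 s : cyl_weight s <= 1.
Proof.
rewrite -(mean1 mL); apply: mean_le => //; first exact: bounded_const.
by move=> x; rewrite /cyl_ind; case: (_ == _).
Qed.

Lemma cyl_weight_shift s :
  cyl_weight s = cyl_weight (true :: s) + cyl_weight (false :: s).
Proof.
rewrite {1}/cyl_weight -(stationary_shift sL) // -meanD //.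
by congr L; apply/funext => x; exact: cyl_ind_shift.
Qed.

(** Two additive functions of cylinders that are close relative to the weight on
all long cylinders are as close on all of them, by splitting. *)
Lemma cylinder_extension_unique (I J : seq bool -> R) :
  (forall s, I s = I (rcons s true) + I (rcons s false)) ->
  (forall s, J s = J (rcons s true) + J (rcons s false)) ->
  (forall e, 0 < e -> exists n, forall s, (n <= size s)%N ->
     `|I s - J s| <= e * cyl_weight s) ->
  forall s, I s = J s.
Proof.
move=> Isplit Jsplit close s; apply/eqP; rewrite -subr_eq0 -normr_eq0.
rewrite eq_le normr_ge0 andbT; apply/ler_addgt0Pr => e e0; rewrite add0r.
have [n near] := close _ e0.
apply: (@le_trans _ _ (e * cyl_weight s)); last first.
  by rewrite ler_piMr ?cyl_weight_le1 // ltW.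
have [k] : exists k, (n <= k + size s)%N by exists n; rewrite leq_addr.
elim: k s => [|k IH] s ns; first exact: near.
rewrite Isplit Jsplit cyl_weight_split opprD addrACA mulrDr.
apply: le_trans (ler_normD _ _) _.
by rewrite lerD // IH // size_rcons addnS.
Qed.

Variable mu : probability borel_past R.
Hypothesis mu_cyl : forall s, mu (cyl s) = (cyl_weight s)%:E.

Lemma shift_invariant (B : set borel_past) : measurable B ->
  mu (past_shift @^-1` B) = mu B.
Proof.
apply: (@borel_past_unique R (shift_measure mu) mu).
  move=> s; rewrite [RHS]mu_cyl cyl_weight_shift EFinD -!mu_cyl.
  rewrite -measureU; [|exact: measurable_cyl..|].
    rewrite /shift_measure; congr (mu _); apply/seteqP; split=> x.
      by move=> xs; case x0 : (x 0%N); [left|right]; apply/cyl_cons.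
    by move=> [/cyl_cons[]|/cyl_cons[]].
  by rewrite -subset0 => x [/cyl_cons[x0 _] /cyl_cons[]]; rewrite x0.
by change (mu setT < +oo)%E; rewrite probability_setT ltry.
Qed.

Section Integral.
Variable h : past -> R.
Hypotheses (h_bounded : bounded_by 1 h)
  (h_unif : uniformly_local h).

Lemma bounded_unif_integrable (A : set borel_past) : measurable A ->
  mu.-integrable A (EFin \o h).
Proof.
move=> mA; apply: measurable_bounded_integrable => //.
- by rewrite (le_lt_trans (probability_le1 _ mA)) ?ltry.
- apply: measurable_funTS; exact: unif_measurable.
- exists 1; split; rewrite ?num_real // => M M1 x _ /=.
  exact: le_trans (h_bounded x) (ltW M1).
Qed.

(** [mu] and [L] integrate [h] in the same way although [L] need not be
countably additive: [h] is nearly constant on long cylinders. *)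
Lemma integral_cyl s :
  (\int[mu]_(x in cyl s) (h x)%:E)%E = (L (fun x => h x * cyl_ind s x))%:E.
Proof.
have bh : bounded_fun h by exists 1.
have bhi t : bounded_fun (fun x => h x * cyl_ind t x) by exact: boundedM.
have mc := measurable_cyl.
have ih t : mu.-integrable (cyl t : set borel_past) (EFin \o h).
  exact: bounded_unif_integrable.
rewrite -[LHS]fineK; last exact: integrable_fin_num.
congr EFin; rewrite -/(Rintegral mu (cyl s) h).
apply: (@cylinder_extension_unique (fun s => Rintegral mu (cyl s) h)
  (fun s => L (fun x => h x * cyl_ind s x))).
- move=> {}s.
  have sub b x : cyl (rcons s b) x <-> cyl s x /\ x (size s) = b.
    rewrite /cyl /mkset size_rcons /mkseq -addn1 iotaD map_cat cats1.
    by split=> [/rcons_inj[-> ->]|[-> ->]].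
  have cylU : cyl s = cyl (rcons s true) `|` cyl (rcons s false).
    apply/seteqP; split=> x; last by move=> [/sub[]|/sub[]].
    by move=> sx; case xs : (x (size s)); [left|right]; apply/sub.
  rewrite {1}cylU Rintegral_setU //; first by rewrite -cylU.
  by apply/disj_setPS => x [/sub[_ xs] /sub[_]]; rewrite xs.
- move=> {}s; rewrite -meanD //; congr L; apply/funext => x.
  by rewrite cyl_ind_rcons mulrDr.
- move=> e e0; have e2 : 0 < e / 2 by rewrite divr_gt0.
  have [n hn] := h_unif e2; exists n => {}s ns.
  pose z : past := nth false s.
  have zh x : cyl s x -> h z - e / 2 <= h x <= h z + e / 2.
    move=> sx; have := hn x z; rewrite -ler_distl; apply => i ilt.
    by rewrite /z -[in RHS](_ : mkseq x (size s) = s) // nth_mkseq // (leq_trans ilt).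
  have wE : cyl_weight s = fine (mu (cyl s)) by rewrite mu_cyl.
  have I1 : Rintegral mu (cyl s) h <= (h z + e / 2) * cyl_weight s.
    rewrite wE -Rintegral_cst //.
    apply: le_Rintegral => //; first exact: finite_measure_integrable_cst.
    by move=> x /zh /andP[].
  have I2 : (h z - e / 2) * cyl_weight s <= Rintegral mu (cyl s) h.
    rewrite wE -Rintegral_cst //.
    apply: le_Rintegral => //; first exact: finite_measure_integrable_cst.
    by move=> x /zh /andP[].
  have J1 : L (fun x => h x * cyl_ind s x) <= (h z + e / 2) * cyl_weight s.
    rewrite /cyl_weight -meanZ //; apply: mean_le => //.
      by apply: boundedM => //; exact: bounded_const.
    move=> x; rewrite /cyl_ind; have [/zh /andP[_]|_] := eqVneq (mkseq x _) s.
      by rewrite !mulr1.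
    by rewrite !mulr0.
  have J2 : (h z - e / 2) * cyl_weight s <= L (fun x => h x * cyl_ind s x).
    rewrite /cyl_weight -meanZ //; apply: mean_le => //.
      by apply: boundedM => //; exact: bounded_const.
    move=> x; rewrite /cyl_ind; have [/zh /andP[+ _]|_] := eqVneq (mkseq x _) s.
      by rewrite !mulr1.
    by rewrite !mulr0.
  by rewrite ler_norml; apply/andP; split; lra.
Qed.

End Integral.

Variable g : past -> R.
Hypothesis gE : forall x, g x = (1 + sgn R (x 0%N) * d (past_shift x)) / 2.

Let cond a (x : past) : R := g (past_cons a x).

Let condE a x : cond a x = (1 + sgn R a * d x) / 2.
Proof. by rewrite /cond gE shift_cons. Qed.

Let cond_bounds a x : 0 < cond a x < 1.
Proof.
rewrite condE; have := d_bounded x; rewrite ler_norml => /andP[h1 h2].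
by rewrite /sgn; case: a; apply/andP; split; lra.
Qed.

Let cond_unif a : uniformly_local (cond a).
Proof.
move=> e /d_unif[n dn]; exists n => x y /dn; rewrite !condE !ler_norml.
by rewrite /sgn; case: a => /andP[h1 h2]; apply/andP; split; lra.
Qed.

Lemma g_unif : uniformly_local g.
Proof.
move=> e /d_unif[n dn]; exists n.+1 => x y xy; rewrite !gE -xy //.
have : `|d (past_shift x) - d (past_shift y)| <= e.
  by apply: dn => i ilt; exact: xy.
rewrite !ler_norml /sgn.
by case: (x 0%N) => /andP[h1 h2]; apply/andP; split; lra.
Qed.

Lemma gfun_g : gfun g.
Proof.
split; first exact/unif_continuous/g_unif.
  move=> x; have := cond_bounds (x 0%N) (past_shift x).
  by rewrite condE gE.
move=> x; rewrite big_bool /= -!/(cond _ _) !condE /sgn; lra.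
Qed.

(** Stationarity on cylinders is the conditional probability given the past. *)
Lemma cond_transfer a s :
  cyl_weight (a :: s) = L (fun x => cond a x * cyl_ind s x).
Proof.
rewrite /cyl_weight -sL //; congr L; apply/funext => x.
rewrite /transfer !cyl_ind_cons condE /sgn.
by case: a => /=; rewrite ?mul1r ?mul0r ?mulr0 ?addr0 ?add0r // ?mulN1r.
Qed.

Lemma is_gmeasure_mean : is_gmeasure g mu.
Proof.
split; [exact: gfun_g|exact: shift_invariant|] => a.
pose h (x : past) := cond a (past_shift x).
have h_unif : uniformly_local h.
  move=> e /(@cond_unif a)[n hn]; exists n.+1 => x y xy.
  by apply: hn => i ilt; exact: xy.
have h_ge0 x : 0 <= h x by case/andP: (cond_bounds a (past_shift x)) => /ltW.
have h1 : bounded_by 1 h.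
  by move=> x; rewrite ger0_norm //; case/andP: (cond_bounds a (past_shift x)) => _ /ltW.
have mh : measurable_fun setT (h : borel_past -> R) by exact: unif_measurable.
have ma : measurable ([set x | x 0%N = a] : set borel_past).
  rewrite (_ : [set x | _] = cyl [:: a]); first exact: measurable_cyl.
  apply/seteqP; split=> x; first by move=> xa; apply/cyl_cons; split.
  by move=> /cyl_cons[].
split.
- move=> Y mY; exists (cond a @^-1` Y); last by rewrite setTI.
  rewrite -[X in measurable X]setTI.
  exact: (unif_measurable (@cond_unif a)).
- exact: bounded_unif_integrable.
- move=> _ [C mC <-]; rewrite setTI setIC.
  apply: (@density_unique R mu h h_ge0 mh (mrestr mu ma)) => //; last first.
    change (mu (setT `&` [set x : past | x 0%N = a]) < +oo)%E.
    by rewrite setTI (le_lt_trans (probability_le1 _ ma)) ?ltry.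
  move=> s; rewrite /= /mrestr.
  have -> : past_shift @^-1` cyl s `&` [set x | x 0%N = a] = cyl (a :: s).
    apply/seteqP; split=> x; first by move=> [sx xa]; apply/cyl_cons.
    by move=> /cyl_cons[xa sx].
  have -> : past_shift @^-1` cyl s = cyl (true :: s) `|` cyl (false :: s).
    apply/seteqP; split=> x; last by move=> [/cyl_cons[]|/cyl_cons[]].
    by move=> xs; case x0 : (x 0%N); [left|right]; apply/cyl_cons.
  rewrite ge0_integral_setU //=; [|exact: measurable_cyl..| | |].
  + rewrite !integral_cyl // -EFinD mu_cyl cond_transfer; congr EFin.
    have bhi t : bounded_fun (fun x => h x * cyl_ind t x).
      by apply: boundedM => //; exists 1.
    rewrite -meanD // -(stationary_shift sL); last first.
      apply: boundedM => //; exists 1 => x.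
      by case/andP: (cond_bounds a x) => /ltW /ger0_norm -> /ltW.
    by congr L; apply/funext => x; rewrite cyl_ind_shift mulrDr.
  + by apply/measurable_EFinP/measurable_funTS.
  + by move=> x _; rewrite lee_fin.
  + by apply/disj_setPS => x [/cyl_cons[x0 _] /cyl_cons[]]; rewrite x0.
Qed.

End Realization.

(** The value on one cylinder is kept, to tell measures apart. *)
Lemma gmeasure_of_mean (R : realType) (d : past -> R) L (g : past -> R) :
  bounded_by (1 / 2) d ->
  uniformly_local d ->
  is_mean L -> stationary d L ->
  (forall x, g x = (1 + sgn R (x 0%N) * d (past_shift x)) / 2) ->
  exists2 mu : probability borel_past R, is_gmeasure g mu &
    mu (cyl [:: true]) = (L (cyl_ind R [:: true]))%:E.
Proof.
move=> d_bounded d_unif mL sL gE.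
have [mu mu_cyl] := exists_cylinder_measure (cyl_weight_ge0 mL)
  (cyl_weight_nil mL) (cyl_weight_split mL).
exists mu; last exact: mu_cyl.
exact: (is_gmeasure_mean d_bounded d_unif mL sL mu_cyl gE).
Qed.
(** * Two measures of the Bramson-Kalikow model *)

Section BramsonKalikow.
Variable R : realType.

Lemma majority_voteE k (x : past) : odd k ->
  majority_vote (1 / 4 : R) k x
  = 1 / 2 + 1 / 4 * (sgn R (x 0%N) * vote R k (past_shift x)).
Proof.
move=> ok; have spinE b : sgn R b = (spin b)%:~R by case: b.
rewrite /majority_vote /vote /fail big_add1 /= big_mkord.
set S : int := \sum_(i < k) _.
have SE : \sum_(i < k) sgn R (past_shift x i) = S%:~R.
  by rewrite /S raddf_sum; apply: eq_bigr => i _; rewrite spinE.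
have := sum_sgn_neq0 R (past_shift x) ok; rewrite SE intr_eq0 lerz0.
rewrite /sgn /spin; case: (x 0%N); rewrite ?mul1r ?mulN1r ?oppr_gt0 ?oppr_lt0.
  by case: ltgtP => //= _ _; field.
by case: ltgtP => //= _ _; field.
Qed.

Lemma BK_limit_drift m (x : past) : (forall j, (0 < j)%N -> odd (m j)) ->
  BK (1 / 4) (fun j => 1 / 2 * (2 / 3) ^+ j) m x
  = (1 + sgn R (x 0%N) * limit_drift R m (past_shift x)) / 2.
Proof.
move=> mo; apply: cvg_lim => //.
rewrite (_ : (fun n => _) = (fun n =>
    1 / 2 - 1 / 2 * (2 / 3) ^+ n +
    sgn R (x 0%N) / 2 * drift R m n (past_shift x))); last first.
  apply/funext => n; rewrite big_nat.
  under eq_bigr => j /andP[j0 _] do rewrite majority_voteE ?mo // mulrDr.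
  rewrite -big_nat big_split /= -mulr_suml.
  have -> : \sum_(1 <= j < n.+1) (1 / 2 * (2 / 3) ^+ j : R) = 1 - (2 / 3) ^+ n.
    by rewrite -[1](expr0 (2 / 3)) -sum_weight.
  rewrite /drift !mulr_sumr; congr (_ + _); first by field.
  by apply: eq_bigr => j _; rewrite /weight; field.
have -> : (1 + sgn R (x 0%N) * limit_drift R m (past_shift x)) / 2 =
  1 / 2 - 1 / 2 * 0 + sgn R (x 0%N) / 2 * limit_drift R m (past_shift x).
  by field.
apply: cvgD; last by apply: cvgMl_tmp; exact: drift_cvg.
apply: cvgB; first exact: cvg_cst.
by apply: cvgMl_tmp; apply: cvg_expr; rewrite ger0_norm; lra.
Qed.

Lemma mean_flip (L : (past -> R) -> R) : is_mean L ->
  is_mean (fun F => L (fun x => F (flip x))).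
Proof.
move=> mL; split; first exact: mean1.
- by move=> a F G bF bG; rewrite (mean_lin mL) //; exact: bounded_comp.
- by move=> F bF F0; apply: (mean_ge0 mL) => //; exact: bounded_comp.
Qed.

Lemma stationary_flip d (L : (past -> R) -> R) : odd_fun d -> stationary d L ->
  stationary d (fun F => L (fun x => F (flip x))).
Proof.
move=> od sL F bF; rewrite -[RHS]sL; last exact: bounded_comp.
congr L; apply/funext => x; rewrite /transfer od !flip_cons /=; ring.
Qed.

End BramsonKalikow.

Theorem corollary1 (R : realType) (c : nat) (m : nat -> nat)
    (c_odd : odd c) (m1 : m 1%N = 217%N)
    (mS : forall j : nat, (1 <= j)%N -> m j.+1 = (c ^ m j)%N)
    (c_ge : (577 <= c)%N) :
  let p : past -> R := BK (1 / 4) (fun j => 1 / 2 * (2 / 3) ^+ j) m in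
  exists mu nu : probability borel_past R,
    [/\ is_gmeasure p mu,
        is_gmeasure p nu &
        exists2 B : set borel_past, measurable B & mu B <> nu B].
Proof.
move=> p; have mo := m_odd c_odd m1 mS.
have pE x : p x = (1 + sgn R (x 0%N) * limit_drift R m (past_shift x)) / 2.
  exact: BK_limit_drift.
have [L [mL sL biased]] := limit_mean R c_odd m1 mS c_ge.
have d2 := @limit_drift_bounded R m; have du := @limit_drift_unif R m.
have [mu mu_g mu1] := gmeasure_of_mean d2 du mL sL pE.
have [nu nu_g nu1] := gmeasure_of_mean d2 du (mean_flip mL)
  (stationary_flip (limit_drift_odd R mo) sL) pE.
exists mu, nu; split=> //; exists (cyl [:: true]); first exact: measurable_cyl.
rewrite mu1 nu1 => -[e].
have bi : bounded_fun (cyl_ind R [:: true]).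
  by exists 1 => x; rewrite /cyl_ind; case: (_ == _); rewrite ?normr1 ?normr0.
have : L (fun x => sgn R (x 0%N)) = 0.
  (* The spin is the difference of the indicators of +1 and -1. *)
  rewrite (_ : (fun x => _) = fun x => cyl_ind R [:: true] x -
      cyl_ind R [:: true] (flip x)).
    by rewrite meanB ?e ?subrr //; exact: bounded_comp.
  apply/funext => x; rewrite /cyl_ind /= !eqseq_cons /flip /sgn.
  by case: (x 0%N); rewrite /= ?subr0 ?sub0r.
lra.
Qed.
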